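(* Let $\mathcal{P}$ be a strongly involutive self-dual polyhedron with underlying graph $\mathcal{G}$, and let $\mathcal{G}_\square$ be its graph of squares, embedded in $\mathbb{S}^2$ by an isometric embedding $i$. Let $\tau$ be a strong involution of $\mathcal{P}$, regarded as an automorphism of $\mathcal{G}_\square$, and let $\tilde\tau$ be the isometry of $\mathbb{S}^2$ realizing $\tau$ under $i$. Then $\tilde\tau$ is the antipodal mapping $\alpha:\mathbb{S}^2\to\mathbb{S}^2$, $\alpha(x)=-x$.
   Context: A polyhedron is a finite simple, planar, 3-connected graph. By Whitney's theorem its embedding in the sphere is essentially unique, so its set $F$ of faces and its dual graph (with vertex set $F$, two faces adjacent iff they share an edge) are well defined. For a vertex $u$ and a face $f$, write $u\in f$ if $u$ lies on the boundary walk of $f$; similarly $e\in f$ if the edge $e$ lies on the boundary of $f$. A duality isomorphism of $\mathcal{P}$ is a graph isomorphism $\tau:\mathcal{P}\to\mathcal{P}^*$ to the dual graph, i.e. a bijection from vertices to faces such that $u,v$ are adjacent vertices iff $\tau(u),\tau(v)$ are adjacent faces; $\mathcal{P}$ is self-dual if one exists. A strong involution is a duality isomorphism $\tau$ such that (1) for all vertices $u,v$: $u\in\tau(v)$ iff $v\in\tau(u)$; (2) $v\notin\tau(v)$ for every vertex $v$. A strongly involutive self-dual polyhedron is one that admits a strong involution. For an edge $(ab)$ of $\mathcal{P}$, $\tau(ab)$ denotes the edge shared by the adjacent faces $\tau(a)$ and $\tau(b)$. The graph of squares $\mathcal{G}_\square$ of $\mathcal{G}$ has vertex set $V(\mathcal{G})\cup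 F(\mathcal{G})\cup E(\mathcal{G})$ (disjoint union of the vertices, faces and edges of $\mathcal{G}$) and edge set $\{(ve): v\in V(\mathcal{G}), e\in E(\mathcal{G}), v\in e\}\cup\{(ef): e\in E(\mathcal{G}), f\in F(\mathcal{G}), e\in f\}$. It is planar, and its faces are quadrilaterals of the form $(vafb)$ with $v\in V(\mathcal{G})$, $a,b\in E(\mathcal{G})$, $f\in F(\mathcal{G})$. A strong involution $\tau$ acts as an automorphism of $\mathcal{G}_\square$ by $v\mapsto\tau(v)$ on vertices, $\tau(v)\mapsto v$ on faces, and $e\mapsto\tau(e)$ on edges of $\mathcal{G}$. An isometric embedding of $\mathcal{G}_\square$ is a topological embedding $i:\mathcal{G}_\square\to\mathbb{S}^2$ such that for every $\sigma\in\mathrm{Aut}(\mathcal{G}_\square)$ there is an isometry $\tilde\sigma$ of $\mathbb{S}^2$ with $\tilde\sigma\circ i=i\circ\sigma$ (so $\tilde\sigma$ maps the image of each vertex $w$ to the image of $\sigma(w)$ and the image of each edge onto the image of its $\sigma$-image). Such an embedding exists by a known result of Servatius and Servatius. Here $\mathbb{S}^2$ is the unit sphere in $\mathbb{R}^3$. *)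

(* Defs.v *)
From HB Require Import structures.
From mathcomp Require Import all_boot all_order all_algebra.
From mathcomp Require Import all_classical all_reals all_analysis.

Set Implicit Arguments.
Unset Strict Implicit.
Unset Printing Implicit Defensive.

Import Order.TTheory GRing.Theory Num.Theory.
Import numFieldNormedType.Exports.

Local Open Scope classical_set_scope.
Local Open Scope ring_scope.

Notation space3 R := 'rV[R]_3.

(* The canonical norm of 'rV[R]_3 is the sup norm, hence an explicit Euclidean
   distance; both induce the same topology. *)
Definition edist (R : realType) (x y : space3 R) : R :=
  Num.sqrt (\sum_(k < 3) (x ord0 k - y ord0 k) ^+ 2).

Definition sphere (R : realType) : set (space3 R) :=
  [set x | \sum_(k < 3) x ord0 k ^+ 2 = 1].

(* Isometries of S^2 are represented by maps of the ambient space, of which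
   only the values on S^2 matter. *)
Definition sphere_isometry (R : realType) (f : space3 R -> space3 R) : Prop :=
  set_bij (@sphere R) (@sphere R) f /\
  forall x y, sphere x -> sphere y -> edist (f x) (f y) = edist x y.

Definition is_arc (R : realType) (x y : space3 R) (A : set (space3 R)) : Prop :=
  exists g : R -> space3 R,
    [/\ {within `[0, 1], continuous g},
        set_inj `[0, 1] g,
        g 0 = x, g 1 = y & A = g @` `[0, 1]].

(* Topological embedding in S^2 of the geometric realization of a finite graph
   on T with adjacency e.  [arc u v] is the image of the closed edge uv and is
   meaningful only when [e u v].  T need not be a finType, because the faces of
   an embedded graph, which are vertices of its graph of squares, do not form
   one. *)
Record embedding (R : realType) (T : Type) (e : rel T) := Embedding {
  pt : T -> space3 R;
  arc : T -> T -> set (space3 R);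
  pt_sphere : forall u, sphere (pt u);
  pt_inj : injective pt;
  arc_sphere : forall u v, e u v -> arc u v `<=` @sphere R;
  arc_sym : forall u v, e u v -> arc u v = arc v u;
  arc_is_arc : forall u v, e u v -> is_arc (pt u) (pt v) (arc u v);
  arc_pt : forall u v w, e u v -> arc u v (pt w) -> w = u \/ w = v;
  arc_meet : forall u v u' v' x, e u v -> e u' v' ->
    arc u v x -> arc u' v' x ->
    [\/ u = u' /\ v = v', u = v' /\ v = u' | exists w, x = pt w]
}.

Definition embedding_image (R : realType) (T : Type) (e : rel T)
    (j : embedding R e) : set (space3 R) :=
  range (pt j) `|` [set x | exists u v, e u v /\ arc j u v x].

Definition simple_graph (V : finType) (e : rel V) : Prop :=
  symmetric e /\ irreflexive e.

Definition three_connected (V : finType) (e : rel V) : Prop :=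
  (3 < #|V|)%N /\
  forall X : {set V}, (#|X| < 3)%N ->
  forall u v, u \notin X -> v \notin X ->
    connect [rel x y | [&& e x y, x \notin X & y \notin X]] u v.

Definition planar (R : realType) (V : finType) (e : rel V) : Prop :=
  inhabited (embedding R e).

Definition polyhedron (R : realType) (V : finType) (e : rel V) : Prop :=
  [/\ simple_graph e, planar R e & three_connected e].

Definition edge_set (V : finType) (e : rel V) : {set {set V}} :=
  [set p : {set V} | [exists u, exists v, e u v && (p == [set u; v]%SET)]]%SET.

Definition edge (V : finType) (e : rel V) : Type :=
  {p : {set V} | p \in edge_set e}.

Section Faces.
Context {R : realType} {V : finType} {e : rel V} (j : embedding R e).

Definition faces : set (set (space3 R)) :=
  [set f | exists2 x, (@sphere R `\` embedding_image j) x &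
           f = connected_component (@sphere R `\` embedding_image j) x].

(* Faces are open in S^2, so this is the frontier of f in S^2. *)
Definition face_boundary (f : faces) : set (space3 R) :=
  closure (val f) `\` val f.

Definition edge_image (a : edge e) : set (space3 R) :=
  [set x | exists u v, [/\ e u v, val a = [set u; v]%SET & arc j u v x]].

Definition vertex_on_face (u : V) (f : faces) : Prop :=
  face_boundary f (pt j u).

Definition edge_on_face (a : edge e) (f : faces) : Prop :=
  edge_image a `<=` face_boundary f.

Definition dual_adj : rel faces := fun f g =>
  `[< f <> g /\ exists a, edge_on_face a f /\ edge_on_face a g >].

Definition duality_isomorphism (tau : V -> faces) : Prop :=
  bijective tau /\ forall u v, e u v = dual_adj (tau u) (tau v).

Definition strong_involution (tau : V -> faces) : Prop :=
  [/\ duality_isomorphism tau,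
      forall u v, vertex_on_face u (tau v) <-> vertex_on_face v (tau u) &
      forall v, ~ vertex_on_face v (tau v)].

Inductive square_vertex : Type :=
  | SqV of V
  | SqF of faces
  | SqE of edge e.

Definition square_adj : rel square_vertex := fun x y =>
  match x, y with
  | SqV v, SqE a | SqE a, SqV v => v \in val a
  | SqE a, SqF f | SqF f, SqE a => `[< edge_on_face a f >]
  | _, _ => false
  end.

(* sigma is the map v |-> tau(v), tau(v) |-> v, ab |-> tau(ab) on the vertices
   of the graph of squares, where tau(ab) is the edge shared by tau(a) and
   tau(b). *)
Definition square_action (tau : V -> faces)
    (sigma : square_vertex -> square_vertex) : Prop :=
  [/\ forall v, sigma (SqV v) = SqF (tau v),
      forall v, sigma (SqF (tau v)) = SqV v &
      forall (p : edge e) a b, val p = [set a; b]%SET ->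
        exists q : edge e, [/\ sigma (SqE p) = SqE q,
          edge_on_face q (tau a) & edge_on_face q (tau b)]].

End Faces.

Arguments square_adj {R V e} j.

Definition graph_automorphism (T : Type) (e : rel T) (sigma : T -> T) : Prop :=
  bijective sigma /\ forall x y, e (sigma x) (sigma y) = e x y.

(* s o i = i o sigma, where an edge is only required to be mapped onto the image
   edge as a set, since sigma does not prescribe a parametrization of edges. *)
Definition realizes (R : realType) (T : Type) (e : rel T) (i : embedding R e)
    (sigma : T -> T) (s : space3 R -> space3 R) : Prop :=
  (forall x, s (pt i x) = pt i (sigma x)) /\
  (forall x y, e x y -> s @` arc i x y = arc i (sigma x) (sigma y)).

Definition isometric_embedding (R : realType) (T : Type) (e : rel T)
    (i : embedding R e) : Prop :=
  forall sigma, graph_automorphism e sigma ->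
  exists s, sphere_isometry s /\ realizes i sigma s.

Definition antipode (R : realType) (x : space3 R) : space3 R := - x.

(* Main.v *)
Require Import Defs.
From mathcomp Require Import all_boot all_order all_algebra.
From mathcomp Require Import all_classical all_reals all_analysis.
From mathcomp Require Import ring lra.

(* The realizing isometry is the restriction of an orthogonal map L, and L is an
   involution because its square fixes the images of the vertices, which are not
   all on a line.  The strong involution fixes no vertex and
   stabilizes no edge of the graph of squares, so L has no fixed point on the
   embedded graph.  Hence L is not the identity, and it is not a reflection,
   since the connected image of the graph would cross the mirror.

   There remains to exclude a half-turn about an axis n.  The image of the graph
   then avoids the axis, and each edge of the graph of squares has a real swing,
   its increment of angle around n.  The four edges around a corner (v, a, f, b)
   form a loop q disjoint from its image -q under the half-turn; since
   q(t) + q(s) never vanishes, q has winding number 0, so the swings satisfy the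
   cocycle relation on every corner of every face.  They therefore define a
   locally trivial cocycle on the sphere carrying the original embedding, and,
   the sphere being simply connected, they are the differences of a potential h.
   Invariance of the swings under the involution s forces h (s w) = h w for all
   vertices w, whereas the angles of w and s w differ by pi.

   That the cells of an embedding by arbitrary arcs fit together as expected
   around an interior point of an edge needs Janiszewski's theorem; it follows
   from the same vanishing of local cocycles, on the punctured sphere, and it
   replaces any use of the Jordan curve theorem. *)

Set Implicit Arguments.
Unset Strict Implicit.
Unset Printing Implicit Defensive.

Import Order.TTheory GRing.Theory Num.Theory.
Import numFieldNormedType.Exports.

Local Open Scope classical_set_scope.
Local Open Scope ring_scope.

(* mathcomp's [path.arc] shadows the arcs of an embedding. *)
Local Notation arc := Defs.arc.

(** * Local cocycles in the plane *)

(** Cousin's lemma, the form in which compactness of a segment is used. The supremum of the [t] for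
    which [P a t] holds can be passed by half the local radius there unless it is already [b]. *)
Lemma cousin (R : realType) (P : R -> R -> Prop) (a b : R) : a <= b ->
  (forall x, a <= x <= b -> exists2 d, 0 < d & forall s t,
     a <= s -> s <= t -> t <= b -> x - d < s -> t < x + d -> P s t) ->
  (forall s t r, a <= s -> s <= t -> t <= r -> r <= b ->
     P s t -> P t r -> P s r) ->
  P a b.
Proof.
move=> ab loc add.
pose E := [set t | a <= t <= b /\ P a t].
have Ea : E a.
  split; first by rewrite lexx.
  have [|d d0 +] := loc a; first by rewrite lexx.
  by apply=> //; lra.
have Eb : has_ubound E by exists b => t [/andP[]].
have supE : has_sup E by split; [exists a|].
have /andP[ac cb] : a <= sup E <= b.
  by rewrite ub_le_sup//= ge_sup //; [exists a|move=> t [/andP[]]].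
have [|d d0 locc] := loc (sup E); first by rewrite ac.
have [t [/andP[at_ tb] Pat] ct] := sup_adherent d0 supE.
have tc : t <= sup E by apply: ub_le_sup => //; split => //; rewrite at_.
(* The point [m] lies beyond the supremum unless it is capped by [b]; as [P a m] holds, it must be
   [b]. *)
pose m := Num.min b (sup E + d / 2).
have Ptm : P t m.
  apply: locc => //; rewrite /m ?ge_min ?lexx// ?le_min ?tb//=; first lra.
  by rewrite gt_min; apply/orP; right; lra.
have Pam : P a m.
  apply: (add a t m) => //; rewrite /m ?ge_min ?lexx// ?le_min ?tb//=; lra.
have mc : m <= sup E.
  apply: ub_le_sup => //; split=> //; rewrite /m ge_min lexx andbT le_min ab/=; lra.
suff -> : b = m by [].
move: mc; rewrite /m; case: (leP b (sup E + d / 2)) => //; lra.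
Qed.

Lemma continuous_pair (T U V : topologicalType) (f : T -> U) (g : T -> V) x :
  {for x, continuous f} -> {for x, continuous g} ->
  {for x, continuous (fun x => (f x, g x))}.
Proof. by move=> cf cg; exact: (cvg_pair cf cg). Qed.

Section LocalCocycles.
Context {R : realType}.

(* A 1-cocycle with locally constant coefficients: [c x] is, near x, a primitive
   vanishing at x, and two such primitives differ by a locally constant
   function. *)
Definition local_cocycle (T : topologicalType) (D : set T) (c : T -> T -> R) :=
  forall x, D x -> \forall z \near x, D z ->
    \forall w \near z, D w -> c x w = c x z + c z w.

Definition primitive (T : topologicalType) (D : set T) (c : T -> T -> R)
    (H : T -> R) :=
  forall x, D x -> \forall w \near x, D w -> H w - H x = c x w.

(** This is the vanishing of the first cohomology with real coefficients, in the guise in which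
    simple connectedness is needed. *)
Definition acyclic (T : topologicalType) (D : set T) :=
  forall c, local_cocycle D c -> exists H, primitive D c H.

Definition locally_constant (T : topologicalType) U (D : set T) (f : T -> U) :=
  forall x, D x -> \forall w \near x, D w -> f w = f x.

(** Connectedness tested on real functions: exactly what makes a primitive unique up to a constant,
    and it passes to continuous images at once. *)
Definition lc_connected (T : topologicalType) (D : set T) :=
  forall f : T -> R, locally_constant D f ->
  forall x y, D x -> D y -> f x = f y.

Lemma connected_locally_constant (T : topologicalType) U (D : set T)
    (f : T -> U) : connected D -> locally_constant D f ->
  forall x y, D x -> D y -> f x = f y.
Proof.
move=> cD lf x y Dx Dy.
suff E : [set w | D w /\ f w = f x] = D.
  by have [] : [set w | D w /\ f w = f x] y by rewrite E.
apply: cD; first by exists x.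
- exists (interior [set w | D w -> f w = f x]); first exact: open_interior.
  apply/seteqP; split => w /=.
    move=> [Dw fw]; split=> //; move: (lf w Dw); apply: filterS => v + Dv.
    by move=> /(_ Dv) ->.
  by move=> [Dw iw]; split=> //; move: Dw; exact: nbhs_singleton iw.
- exists (closure [set w | D w /\ f w = f x]); first exact: closed_closure.
  apply/seteqP; split => w /=.
    by move=> [Dw fw]; split=> //; apply: subset_closure.
  move=> [Dw cw]; split=> //; have [v [[Dv fv] Hv]] := cw _ (lf w Dw).
  by rewrite -Hv.
Qed.

Lemma connected_lc (T : topologicalType) (D : set T) :
  connected D -> lc_connected D.
Proof. by move=> cD f; exact: connected_locally_constant. Qed.

Lemma lc_connected_image (T T' : topologicalType) (phi : T' -> T) :
  continuous phi -> lc_connected [set: T'] -> lc_connected (range phi).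
Proof.
move=> cphi cT' f lf _ _ [x _ <-] [y _ <-].
apply: (cT' (f \o phi)) => // z _ /=.
have /cphi := lf (phi z) (ex_intro2 _ _ z I erefl); rewrite nbhs_simpl/=.
by apply: filterS => w /= + _; apply; exists w.
Qed.

Lemma path_lc_connected (T : topologicalType) (D : set T) :
  (forall x y, D x -> D y -> exists g : R -> T,
     [/\ continuous g, forall t, 0 <= t <= 1 -> D (g t), g 0 = x & g 1 = y]) ->
  lc_connected D.
Proof.
move=> pD f lf x y Dx Dy; have [g [cg Dg <- <-]] := pD x y Dx Dy.
apply: (@connected_locally_constant _ _ (`[0, 1] : set R) (f \o g) _ _ 0 1).
- exact: segment_connected.
- move=> t /=; rewrite in_itv/= => t01; have := lf _ (Dg _ t01).
  move/cg; rewrite nbhs_simpl/=; apply: filterS => w /=.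
  by rewrite in_itv/= => + w01; apply; exact: Dg.
- by rewrite /= in_itv/= lexx ler01.
- by rewrite /= in_itv/= lexx ler01.
Qed.

Lemma primitive_subset (T : topologicalType) (D D' : set T) c H :
  D' `<=` D -> primitive D c H -> primitive D' c H.
Proof.
by move=> D'D pH x /D'D /pH; apply: filterS => w + /D'D.
Qed.

Lemma primitiveB (T : topologicalType) (D : set T) c H1 H2 :
  primitive D c H1 -> primitive D c H2 -> locally_constant D (H1 \- H2).
Proof.
move=> p1 p2 x Dx; apply: filterS2 (p1 x Dx) (p2 x Dx) => w h1 h2 Dw /=.
by have := h1 Dw; rewrite -(h2 Dw); lra.
Qed.

(** The gluing step of Mayer-Vietoris: on the connected overlap the two primitives differ by a
    constant, which is absorbed into [H2]. The two local conditions are phrased so as to cover both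
    closed pieces (boxes) and open ones (punctured spheres). *)
Lemma primitive_glue (T : topologicalType) (D1 D2 : set T) c H1 H2 x0 :
  D1 x0 -> D2 x0 -> lc_connected (D1 `&` D2) ->
  (forall x, D1 x -> ~ D2 x -> \forall w \near x, D2 w -> D1 w) ->
  (forall x, D2 x -> ~ D1 x -> \forall w \near x, D1 w -> D2 w) ->
  primitive D1 c H1 -> primitive D2 c H2 ->
  exists H, primitive (D1 `|` D2) c H.
Proof.
move=> D10 D20 cD o1 o2 p1 p2.
pose k := H1 x0 - H2 x0.
have Hk x : D1 x -> D2 x -> H1 x = H2 x + k.
  move=> D1x D2x; suff : (H1 \- H2) x = (H1 \- H2) x0 by rewrite /k /=; lra.
  apply: cD => //; apply: (@primitiveB _ _ c).
    by apply: primitive_subset p1 => ? [].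
  by apply: primitive_subset p2 => ? [].
pose H x := if `[< D1 x >] then H1 x else H2 x + k.
have E1 x : D1 x -> H x = H1 x by rewrite /H; case: asboolP.
have E2 x : D2 x -> H x = H2 x + k.
  by move=> D2x; rewrite /H; case: asboolP => // D1x; rewrite Hk.
exists H => x Dx.
have n1 : D1 x -> \forall w \near x, D1 w -> H w - H x = c x w.
  move=> D1x; move: (p1 x D1x); apply: filterS => w + D1w.
  by rewrite !E1 => // ->.
have n2 : D2 x -> \forall w \near x, D2 w -> H w - H x = c x w.
  move=> D2x; move: (p2 x D2x); apply: filterS => w + D2w.
  by rewrite !E2 => // /(_ D2w) <-; ring.
have [D1x|nD1x] := pselect (D1 x); have [D2x|nD2x] := pselect (D2 x).
- by apply: filterS2 (n1 D1x) (n2 D2x) => w h1 h2 [].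
- apply: filterS2 (n1 D1x) (o1 x D1x nD2x) => w h1 h2 [//|/h2]; exact: h1.
- apply: filterS2 (n2 D2x) (o2 x D2x nD1x) => w h1 h2 [/h2|//]; exact: h1.
- by case: Dx.
Qed.

(** * Primitives on boxes and on the plane *)

Section Plane.
Variable c : R * R -> R * R -> R.
Hypothesis coc : local_cocycle setT c.

Definition box (a b a' b' : R) : set (R * R) :=
  [set p | a <= p.1 <= b /\ a' <= p.2 <= b'].

Lemma segment_continuous (p q : R * R) :
  continuous (fun t : R => (p.1 + t * (q.1 - p.1), p.2 + t * (q.2 - p.2))).
Proof.
move=> t; apply: (@continuous_pair R R R (fun t : R => p.1 + t * (q.1 - p.1))
  (fun t : R => p.2 + t * (q.2 - p.2))); apply: cvgD; try exact: cvg_cst;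
  apply: cvgM; [exact: cvg_id|exact: cvg_cst|exact: cvg_id|exact: cvg_cst].

Qed.

Lemma box_lc_connected a b a' b' : lc_connected (box a b a' b').
Proof.
apply: path_lc_connected => p q [p1 p2] [q1 q2].
exists (fun t : R => (p.1 + t * (q.1 - p.1), p.2 + t * (q.2 - p.2))).
split; first exact: segment_continuous.
- move=> t t01; split=> /=; nra.
- by case: p {p1 p2} => ? ? /=; congr pair; ring.
- by case: p q {p1 p2 q1 q2} => ? ? [? ?] /=; congr pair; ring.
Qed.

Lemma box_closed a b a' b' : closed (box a b a' b').
Proof.
have -> : box a b a' b' = fst @^-1` `[a, b] `&` snd @^-1` `[a', b'].
  by apply/seteqP; split => p; rewrite /box/= !in_itv.
apply: closedI; apply: closed_comp => [? _|]; try exact: itv_closed;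
  [exact: cvg_fst|exact: cvg_snd].
Qed.

Let good a b a' b' := exists H, primitive (box a b a' b') c H.

Lemma closed_escape (T : topologicalType) (A : set T) x :
  closed A -> ~ A x -> \forall w \near x, ~ A w.
Proof. by move=> cA nAx; apply: open_nbhs_nbhs; split=> //; rewrite openC. Qed.

(** The cocycle relation says that [c x] itself is a primitive near [x]. *)
Lemma local_good x : exists2 d, 0 < d & forall a b a' b',
  x.1 - d < a -> b < x.1 + d -> x.2 - d < a' -> b' < x.2 + d -> good a b a' b'.
Proof.
have /nbhs_ballP[d /= d0 Bd] := coc (x := x) I.
exists d => // a b a' b' xa xb xa' xb'; exists (c x) => z -[z1 z2].
have /Bd/(_ I) : ball x d z.
  by split; rewrite /ball /= ltr_norml; apply/andP; split; lra.
by apply: filterS => w /(_ I) ->; lra.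
Qed.

Lemma good_glue1 a m b a' b' : a <= m -> m <= b -> a' <= b' ->
  good a m a' b' -> good m b a' b' -> good a b a' b'.
Proof.
move=> am mb ab' [H1 p1] [H2 p2]; rewrite /good.
have -> : box a b a' b' = box a m a' b' `|` box m b a' b'.
  apply/seteqP; split => -[s t]; rewrite /box /=.
    by move=> [] /andP[s1 s2] t12; have [?|/ltW ?] := leP s m; [left|right];
      split=> //; apply/andP.
  by move=> [] [/andP[s1 s2] t12]; split=> //; apply/andP; split=> //; lra.
apply: (@primitive_glue _ _ _ c H1 H2 (m, a')) => //;
  rewrite /box/= ?lexx ?am ?mb ?ab' //.
- have -> : box a m a' b' `&` box m b a' b' = box m m a' b'; last first.
    exact: box_lc_connected.
  apply/seteqP; split => -[s t] /=; rewrite /box /=.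
    by move=> [[/andP[s1 s2] t12] [/andP[s1' s2'] _]]; split=> //; apply/andP.
  by move=> [/andP[s1 s2] t12]; split; split=> //; apply/andP; split=> //; lra.
- move=> x _ nx; have := closed_escape (@box_closed m b a' b') nx.
  by apply: filterS.
- move=> x _ nx; have := closed_escape (@box_closed a m a' b') nx.
  by apply: filterS.
Qed.

Lemma good_glue2 a b a' m b' : a <= b -> a' <= m -> m <= b' ->
  good a b a' m -> good a b m b' -> good a b a' b'.
Proof.
move=> ab am mb [H1 p1] [H2 p2]; rewrite /good.
have -> : box a b a' b' = box a b a' m `|` box a b m b'.
  apply/seteqP; split => -[t s]; rewrite /box /=.
    by move=> [] t12 /andP[s1 s2]; have [?|/ltW ?] := leP s m; [left|right];
      split=> //; apply/andP.
  by move=> [] [t12 /andP[s1 s2]]; split=> //; apply/andP; split=> //; lra.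
apply: (@primitive_glue _ _ _ c H1 H2 (a, m)) => //;
  rewrite /box/= ?lexx ?am ?mb ?ab //.
- have -> : box a b a' m `&` box a b m b' = box a b m m; last first.
    exact: box_lc_connected.
  apply/seteqP; split => -[t s] /=; rewrite /box /=.
    by move=> [[t12 /andP[s1 s2]] [_ /andP[s1' s2']]]; split=> //; apply/andP.
  by move=> [t12 /andP[s1 s2]]; split; split=> //; apply/andP; split=> //; lra.
- move=> x _ nx; have := closed_escape (@box_closed a b m b') nx.
  by apply: filterS.
- move=> x _ nx; have := closed_escape (@box_closed a b a' m) nx.
  by apply: filterS.
Qed.

(** Cousin's lemma is applied twice: vertically, to find a strip of positive width around each
    abscissa on which primitives exist, then horizontally, to glue the strips. *)
Lemma box_good a b a' b' : a <= b -> a' <= b' -> good a b a' b'.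
Proof.
move=> ab ab'; apply: (@cousin _ (fun s t => good s t a' b')) => //; last first.
  by move=> s t r _ st tr _; exact: good_glue1.
move=> x _.
have : exists2 d, 0 < d & forall a b, x - d < a -> a <= b -> b < x + d ->
    good a b a' b'.
  apply: (@cousin _ (fun s t => exists2 d, 0 < d &
    forall a b, x - d < a -> a <= b -> b < x + d -> good a b s t)) => //.
    move=> y _; have [d d0 Hd] := local_good (x, y).
    by exists d => // s t _ _ _ ys yt; exists d => // ? ? ? ? ?; exact: Hd.
  move=> s t r _ st tr _ [d1 d10 H1] [d2 d20 H2].
  exists (Num.min d1 d2); first by rewrite lt_min d10.
  move=> u v xu uv vx; apply: (good_glue2 (m := t)) => //.
    apply: H1 => //; move: xu vx; case: (leP d1 d2) => ? ? ?; lra.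
  apply: H2 => //; move: xu vx; case: (leP d1 d2) => ? ? ?; lra.
by move=> [d d0 Hd]; exists d => // s t _ st _ xs xt; exact: Hd.
Qed.

Lemma plane_primitive : exists H, primitive setT c H.
Proof.
have /choice[G pG] : forall n : nat,
    exists H, primitive (box (- n%:R) n%:R (- n%:R) n%:R) c H.
  by move=> n; apply: box_good; rewrite ge0_cp ?ler0n.
(* Exhaustion by the boxes of half-side n: primitives on them, normalised to vanish at the origin,
   agree wherever they are both defined. *)
pose N (w : R * R) : nat := (Num.truncn (`|w.1| + `|w.2|)).+1.
pose B (n : nat) := box (- n%:R) n%:R (- n%:R) n%:R.
have N_in w n : (N w <= n)%N -> B n w.
  move=> Nn; have : `|w.1| + `|w.2| < n%:R.
    by apply: lt_le_trans (_ : (N w)%:R <= _); [exact: truncnS_gt|rewrite ler_nat].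
  have := normr_ge0 w.1; have := normr_ge0 w.2.
  move=> h1 h2 h3; split; rewrite -ler_norml; lra.
have B0 n : B n (0, 0) by rewrite /B /box/= lerNl oppr0 ler0n.
have BS m n : (m <= n)%N -> B m `<=` B n.
  rewrite -(ler_nat R) => mn [s t] [/= /andP[s1 s2] /andP[t1 t2]].
  by split=> /=; apply/andP; split; lra.
have Gmn m n w : (m <= n)%N -> B m w -> G m w - G m (0, 0) = G n w - G n (0, 0).
  move=> mn Bw; suff : G m w - G n w = G m (0, 0) - G n (0, 0) by move=> ?; lra.
  apply: (@box_lc_connected (- m%:R) m%:R (- m%:R) m%:R (G m \- G n)) => //.
    apply: (@primitiveB _ _ c); first exact: pG.
    by apply: primitive_subset (pG n); exact: BS.
  exact: B0.
have GE m n w : B m w -> B n w -> G m w - G m (0, 0) = G n w - G n (0, 0).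
  move=> Bm Bn; have [mn|/ltnW nm] := leqP m n; first exact: Gmn.
  by symmetry; exact: Gmn.
exists (fun w => G (N w) w - G (N w) (0, 0)) => x _.
(* One extra unit of margin lets a single box serve all [w] at distance less than 1 from [x]. *)
have Bx : B (N x).+1 x by apply: N_in.
have nB : \forall w \near x, B (N x).+1 w.
  apply/nbhs_ballP; exists 1 => //= w [].
  rewrite /ball/= => w1 w2.
  have xN : `|x.1| + `|x.2| < (N x)%:R by exact: truncnS_gt.
  have := normr_ge0 x.1; have := normr_ge0 x.2; move=> h2 h1.
  have h3 : `|w.1| <= `|x.1| + 1.
    rewrite -[w.1](subrK x.1) addrC (le_trans (ler_normD _ _))// lerD2l.
    by rewrite distrC ltW.
  have h4 : `|w.2| <= `|x.2| + 1.
    rewrite -[w.2](subrK x.2) addrC (le_trans (ler_normD _ _))// lerD2l.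
    by rewrite distrC ltW.
  by split; rewrite -ler_norml -natr1; lra.
apply: filterS2 nB (pG _ _ Bx) => w Bw /(_ Bw) <- _.
rewrite (GE _ _ _ (N_in w _ (leqnn _)) Bw) (GE _ _ _ (N_in x _ (leqnn _)) Bx); ring.
Qed.

End Plane.

Lemma plane_acyclic : acyclic [set: R * R].
Proof. by move=> c; exact: plane_primitive. Qed.

Lemma plane_lc_connected : lc_connected [set: R * R].
Proof.
apply: path_lc_connected => p q _ _.
exists (fun t : R => (p.1 + t * (q.1 - p.1), p.2 + t * (q.2 - p.2))).
split=> //; first exact: segment_continuous.
- by case: p => ? ? /=; congr pair; ring.
- by case: p q => ? ? [? ?] /=; congr pair; ring.
Qed.

End LocalCocycles.

(** * Frames and stereographic projection *)

Section Dot.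
Context {R : realType}.
Implicit Types x y z a b u : space3 R.

Definition dot x y : R := \sum_(k < 3) x ord0 k * y ord0 k.

Lemma dotC x y : dot x y = dot y x.
Proof. by apply: eq_bigr => k _; rewrite mulrC. Qed.

Lemma dotDl x y z : dot (x + y) z = dot x z + dot y z.
Proof. by rewrite /dot -big_split; apply: eq_bigr => k _; rewrite mxE mulrDl. Qed.

Lemma dotZl r x y : dot (r *: x) y = r * dot x y.
Proof. by rewrite /dot mulr_sumr; apply: eq_bigr => k _; rewrite mxE mulrA. Qed.

Lemma dotNl x y : dot (- x) y = - dot x y.
Proof. by rewrite -scaleN1r dotZl mulN1r. Qed.

Lemma dotDr x y z : dot x (y + z) = dot x y + dot x z.
Proof. by rewrite dotC dotDl !(dotC x). Qed.

Lemma dotZr r x y : dot x (r *: y) = r * dot x y.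
Proof. by rewrite dotC dotZl dotC. Qed.

Lemma dotNr x y : dot x (- y) = - dot x y.
Proof. by rewrite dotC dotNl dotC. Qed.

Definition dotE := (dotDl, dotDr, dotNl, dotNr, dotZl, dotZr).

Lemma dot_ge0 x : 0 <= dot x x.
Proof. by apply: sumr_ge0 => k _; rewrite -expr2 sqr_ge0. Qed.

Lemma dot_eq0 x : dot x x = 0 -> x = 0.
Proof.
move=> /eqP; rewrite psumr_eq0 => [/allP x0|k _]; last by rewrite -expr2 sqr_ge0.
apply/rowP => k; rewrite mxE; apply/eqP.
by have := x0 k (mem_index_enum k); rewrite mulf_eq0 orbb.
Qed.

Lemma sphereE x : sphere x <-> dot x x = 1.
Proof. by rewrite /sphere /dot /=; under eq_bigr do rewrite expr2. Qed.

Lemma sphere_opp x : sphere x -> sphere (- x).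
Proof. by move=> /sphereE xx; apply/sphereE; rewrite !dotE opprK. Qed.

Lemma sphere_dot_lt1 x u : sphere x -> sphere u -> x <> u -> dot x u < 1.
Proof.
move=> /sphereE xx /sphereE uu xu; have := dot_ge0 (x - u).
rewrite le_eqVlt => /orP[/eqP/esym/dot_eq0/eqP|].
  by rewrite subr_eq0 => /eqP.
by rewrite !dotE xx uu (dotC u x); lra.
Qed.

Definition frame a b u :=
  [/\ [/\ dot a a = 1, dot b b = 1 & dot u u = 1],
      dot a b = 0, dot a u = 0 & dot b u = 0].

(** The rows of [M] are orthonormal, and a right inverse of a square matrix is also a left
    inverse. *)
Lemma frame_expand a b u x : frame a b u ->
  x = dot x a *: a + dot x b *: b + dot x u *: u.
Proof.
move=> [[aa bb uu] ab au bu].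
pose F k := nth 0 [:: a; b; u] k.
pose M : 'M[R]_3 := \matrix_(i < 3) F i.
have ME (i j : 'I_3) : M i j = F i ord0 j by rewrite mxE.
have MM : M *m M^T = 1%:M.
  apply/matrixP => i j; rewrite [LHS]mxE [RHS]mxE.
  under eq_bigr do rewrite [M^T _ _]mxE !ME.
  change (dot (F i) (F j) = (i == j)%:R).
  by case: i => -[|[|[|//]]] ? /=; case: j => -[|[|[|//]]] ? /=;
    rewrite /F//= ?(dotC b a) ?(dotC u a) ?(dotC u b).
have := mulmx1C MM => MTM.
rewrite -[LHS]mulmx1 -MTM mulmxA; apply/rowP => j; rewrite [LHS]mxE.
have xM (i : 'I_3) : (x *m M^T) ord0 i = dot x (F i).
  by rewrite mxE; apply: eq_bigr => k _; rewrite [M^T _ _]mxE ME.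
by rewrite !big_ord_recl big_ord0 addr0 !xM !ME /F/= !mxE addrA.
Qed.

Lemma dot3 x y : dot x y =
  x ord0 ord0 * y ord0 ord0 + x ord0 (lift ord0 ord0) * y ord0 (lift ord0 ord0)
  + x ord0 (lift ord0 (lift ord0 ord0)) * y ord0 (lift ord0 (lift ord0 ord0)).
Proof. by rewrite /dot !big_ord_recl big_ord0 addr0 addrA. Qed.

Lemma dot_continuous u : continuous (fun x => dot x u).
Proof.
have c (k : 'I_3) : continuous (fun x : space3 R => x ord0 k * u ord0 k).
  move=> x; apply: (@continuousM R (space3 R) (fun x => x ord0 k)).
    exact: (@coord_continuous R 1 3 ord0 k x).
  exact: cst_continuous.
have -> : (fun x => dot x u) = (fun x : space3 R =>
    x ord0 ord0 * u ord0 ord0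
    + x ord0 (lift ord0 ord0) * u ord0 (lift ord0 ord0)
    + x ord0 (lift ord0 (lift ord0 ord0)) * u ord0 (lift ord0 (lift ord0 ord0))).
  by apply/funext => x; exact: dot3.
by move=> x; exact: (continuousD (continuousD (c _ x) (c _ x)) (c _ x)).
Qed.

Definition vec3 (r s t : R) : space3 R := \row_(k < 3) nth 0 [:: r; s; t] k.

Lemma dot_vec3 r s t x : dot (vec3 r s t) x =
  r * x ord0 ord0 + s * x ord0 (lift ord0 ord0)
  + t * x ord0 (lift ord0 (lift ord0 ord0)).
Proof. by rewrite dot3 !mxE. Qed.

(** The witness is the cross product, whose norm comes from Lagrange's identity. *)
Lemma frame_cross a b : dot a a = 1 -> dot b b = 1 -> dot a b = 0 ->
  exists u, frame a b u.
Proof.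
rewrite !dot3.
set a0 : R := a _ _; set a1 : R := a _ _; set a2 : R := a _ _.
set b0 : R := b _ _; set b1 : R := b _ _; set b2 : R := b _ _.
move=> aa bb ab.
exists (vec3 (a1 * b2 - a2 * b1) (a2 * b0 - a0 * b2) (a0 * b1 - a1 * b0)).
split; rewrite 1?[dot a (vec3 _ _ _)]dotC 1?[dot b (vec3 _ _ _)]dotC.
- split; rewrite ?dot_vec3 ?dot3 ?mxE /= -/a0 -/a1 -/a2 -/b0 -/b1 -/b2 //.
  transitivity ((a0 * a0 + a1 * a1 + a2 * a2) * (b0 * b0 + b1 * b1 + b2 * b2)
    - (a0 * b0 + a1 * b1 + a2 * b2) ^+ 2); first ring.
  by rewrite aa bb ab; ring.
- by rewrite dot3.
- by rewrite dot_vec3 -/a0 -/a1 -/a2; ring.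
- by rewrite dot_vec3 -/b0 -/b1 -/b2; ring.
Qed.

Lemma frame_rot a b u : frame a b u -> frame b u a.
Proof. by move=> [[? ? ?] ? ? ?]; split=> //; rewrite dotC. Qed.

Lemma normalize x : x <> 0 -> exists2 r, r != 0 & dot (r *: x) (r *: x) = 1.
Proof.
move=> x0; have dx : 0 < dot x x.
  by rewrite lt_neqAle dot_ge0 andbT eq_sym; apply/eqP => /dot_eq0.
exists (Num.sqrt (dot x x))^-1; first by rewrite invr_eq0 sqrtr_eq0 -ltNge.
rewrite !dotE mulrA -expr2 exprVn sqr_sqrtr ?dot_ge0// mulVf// gt_eqF//.
Qed.

Lemma orthogonal_unit u : exists2 a, dot a a = 1 & dot u a = 0.
Proof.
have [u00|u00] := eqVneq (u ord0 ord0) 0.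
  exists (vec3 1 0 0); first by rewrite dot_vec3 !mxE /=; ring.
  by rewrite dotC dot_vec3 u00; ring.
pose v := vec3 (- u ord0 (lift ord0 ord0)) (u ord0 ord0) 0.
have [|r r0 rv] := @normalize v.
  move/rowP/(_ (lift ord0 ord0)); rewrite !mxE /= => /eqP; exact/negP.
exists (r *: v) => //; rewrite dotZr dotC dot_vec3; ring.
Qed.

Lemma frame_exists u : dot u u = 1 -> exists a b, frame a b u.
Proof.
move=> uu; have [a aa ua] := orthogonal_unit u.
have [b /frame_rot uab] := frame_cross uu aa ua; by exists a, b.
Qed.

End Dot.

Section Stereographic.
Context {R : realType} (a b u : space3 R).
Hypothesis abu : frame a b u.

Definition stereo (x : space3 R) : R * R :=
  (dot x a / (1 - dot x u), dot x b / (1 - dot x u)).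

Definition unstereo (p : R * R) : space3 R :=
  (p.1 ^+ 2 + p.2 ^+ 2 + 1)^-1 *:
  ((2 * p.1) *: a + (2 * p.2) *: b + (p.1 ^+ 2 + p.2 ^+ 2 - 1) *: u).

Let den_gt0 (p : R * R) : 0 < p.1 ^+ 2 + p.2 ^+ 2 + 1.
Proof. by have := sqr_ge0 p.1; have := sqr_ge0 p.2; lra. Qed.

Let abuE : [/\ dot a a = 1, dot b b = 1 & dot u u = 1] /\
  [/\ dot a b = 0, dot a u = 0 & dot b u = 0] /\
  [/\ dot b a = 0, dot u a = 0 & dot u b = 0].
Proof. by case: abu => -[? ? ?] ? ? ?; do 2!split=> //; split; rewrite // dotC. Qed.

Lemma unstereo_coord p : let n := (p.1 ^+ 2 + p.2 ^+ 2 + 1)^-1 in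
  [/\ dot (unstereo p) a = n * (2 * p.1), dot (unstereo p) b = n * (2 * p.2) &
      dot (unstereo p) u = n * (p.1 ^+ 2 + p.2 ^+ 2 - 1)].
Proof.
case: abuE => -[aa bb uu] [[ab au bu] [ba ua ub]].
by split; rewrite /unstereo !dotE ?aa ?bb ?uu ?ab ?au ?bu ?ba ?ua ?ub; ring.
Qed.

Lemma sphere_frame x : sphere x <->
  dot x a ^+ 2 + dot x b ^+ 2 + dot x u ^+ 2 = 1.
Proof.
suff -> : dot x a ^+ 2 + dot x b ^+ 2 + dot x u ^+ 2 = dot x x by exact: sphereE.
transitivity (dot x (dot x a *: a + dot x b *: b + dot x u *: u)).
  by rewrite !dotE !expr2.
by rewrite -frame_expand.
Qed.

Lemma unstereo_sphere p : sphere (unstereo p).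
Proof.
apply/sphere_frame; case: (unstereo_coord p) => -> -> ->.
by have := den_gt0 p => d0; field; rewrite gt_eqF.
Qed.

Lemma unstereo_neq p : unstereo p <> u.
Proof.
case: (unstereo_coord p) => _ _ + E; rewrite E.
case: abuE => -[_ _ ->] _; have := den_gt0 p => d0.
move/(congr1 (fun t => t * (p.1 ^+ 2 + p.2 ^+ 2 + 1))).
rewrite mulrAC mulVf ?gt_eqF//; lra.
Qed.

Lemma unstereoK p : stereo (unstereo p) = p.
Proof.
rewrite /stereo; case: (unstereo_coord p) => -> -> ->.
have d0 := den_gt0 p; case: p d0 => s t /= d0.
have d1 : s ^+ 2 + t ^+ 2 + 1 != 0 by rewrite gt_eqF.
have E : 1 - (s ^+ 2 + t ^+ 2 + 1)^-1 * (s ^+ 2 + t ^+ 2 - 1)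
  = 2 / (s ^+ 2 + t ^+ 2 + 1) by field.
by rewrite E; congr pair; field.
Qed.

Lemma stereoK x : sphere x -> x <> u -> unstereo (stereo x) = x.
Proof.
move=> Sx xu; have Su : sphere u by apply/sphereE; case: abuE => -[].
have := sphere_dot_lt1 Sx Su xu; move/sphere_frame : Sx.
move=> E Z1; transitivity (dot x a *: a + dot x b *: b + dot x u *: u);
  last by rewrite -frame_expand.
rewrite /unstereo /stereo /=; move: E Z1.
move: (dot x a) (dot x b) (dot x u) => X Y Z E Z1.
have z0 : 1 - Z != 0 by rewrite gt_eqF//; lra.
have E2 : (X / (1 - Z)) ^+ 2 + (Y / (1 - Z)) ^+ 2 = (1 + Z) / (1 - Z).
  by rewrite !expr_div_n -mulrDl (_ : X ^+ 2 + Y ^+ 2 = (1 - Z) * (1 + Z));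
    [field|lra].
rewrite E2.
have -> : (1 + Z) / (1 - Z) + 1 = 2 / (1 - Z) by field.
have -> : (1 + Z) / (1 - Z) - 1 = 2 * Z / (1 - Z) by field.
by rewrite !scalerDr !scalerA; congr (_ *: _ + _ *: _ + _ *: _); field.
Qed.

Lemma unstereo_range : range unstereo = @sphere R `\ u.
Proof.
apply/seteqP; split => [_ [p _ <-]|x [Sx xu]].
  by split; [exact: unstereo_sphere|exact: unstereo_neq].
by exists (stereo x) => //; exact: stereoK.
Qed.

Lemma unstereo_continuous : continuous unstereo.
Proof.
have c1 : continuous (fun p : R * R => p.1) by move=> ?; exact: cvg_fst.
have c2 : continuous (fun p : R * R => p.2) by move=> ?; exact: cvg_snd.
have cq : continuous (fun p : R * R => p.1 ^+ 2 + p.2 ^+ 2).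
  by move=> p; apply: cvgD; apply: cvgM; solve [exact: c1|exact: c2].
move=> p; apply: cvgZ.
  apply: cvgV; first by rewrite gt_eqF.
  by apply: cvgD; [exact: cq|exact: cvg_cst].
apply: cvgD; first apply: cvgD.
- apply: cvgZ; last exact: cvg_cst.
  by apply: cvgM; [exact: cvg_cst|exact: c1].
- apply: cvgZ; last exact: cvg_cst.
  by apply: cvgM; [exact: cvg_cst|exact: c2].
- apply: cvgZ; last exact: cvg_cst.
  by apply: cvgB; [exact: cq|exact: cvg_cst].
Qed.

Lemma stereo_continuous x : dot x u != 1 -> {for x, continuous stereo}.
Proof.
move=> xu.
have c v : {for x, continuous (fun x => dot x v / (1 - dot x u))}.
  have d1 : {for x, continuous (fun x => 1 - dot x u)}.
    apply: (@continuousB R R (space3 R) (fun=> 1)); first exact: cst_continuous.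
    exact: dot_continuous.
  apply: (@continuousM R (space3 R) (fun x => dot x v)).
    exact: dot_continuous.
  apply: (@continuousV R (space3 R)) => //.
  by rewrite subr_eq0 eq_sym.
exact: (continuous_pair (c a) (c b)).
Qed.

End Stereographic.

(** * Local cocycles on the sphere and Janiszewski's theorem *)

Lemma unit_angle (R : realType) (s t : R) : s ^+ 2 + t ^+ 2 = 1 ->
  exists th : R, s = cos th /\ t = sin th.
Proof.
move=> st; have s1 : -1 <= s <= 1 by have := sqr_ge0 t => ?; apply/andP; split; nra.
have cs : cos (acos s) = s by apply: acosK; rewrite in_itv.
have ss : sin (acos s) = `|t|.
  rewrite sin_acos// (_ : 1 - s ^+ 2 = t ^+ 2) ?sqrtr_sqr//; lra.
have [t0|t0] := lerP 0 t.
  by exists (acos s); rewrite cs ss ger0_norm.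
by exists (- acos s); rewrite cosN sinN cs ss ltr0_norm// opprK.
Qed.

Lemma polar (R : realType) (s t : R) : (s, t) <> (0, 0) ->
  exists r th : R, s = expR r * cos th /\ t = expR r * sin th.
Proof.
move=> st0; have st : 0 < s ^+ 2 + t ^+ 2.
  rewrite lt_neqAle addr_ge0 ?sqr_ge0// andbT eq_sym paddr_eq0 ?sqr_ge0//.
  by rewrite !sqrf_eq0; apply/negP => /andP[/eqP s0 /eqP t0]; rewrite s0 t0 in st0.
pose m := Num.sqrt (s ^+ 2 + t ^+ 2).
have m0 : 0 < m by rewrite sqrtr_gt0.
have mm : m ^+ 2 = s ^+ 2 + t ^+ 2 by rewrite sqr_sqrtr// ltW.
have [|th [cth sth]] := @unit_angle _ (s / m) (t / m).
  by rewrite !expr_div_n -mulrDl -mm divff// expf_neq0// gt_eqF.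
exists (ln m), th; rewrite lnK ?posrE// -cth -sth.
by split; rewrite mulrC divfK// gt_eqF.
Qed.

Section Joined.
Context {R : realType}.

Lemma stereo_eq0 (a b u x : space3 R) : frame a b u -> sphere x -> x <> u ->
  stereo a b u x = (0, 0) -> x = - u.
Proof.
move=> abu Sx xu E; rewrite -(stereoK abu Sx xu) E /unstereo /=.
rewrite !(mulr0, expr2, scale0r, add0r, invr1, scale1r); exact: scaleN1r.
Qed.

(** Cocycles are pulled back along [phi] and primitives along [rho]. Continuity of [rho] is asked at
    points of the range only, since stereographic projection is not continuous at its pole. *)
Lemma acyclic_homeo (T T' : topologicalType) (phi : T' -> T) (rho : T -> T') :
  continuous phi -> (forall y, rho (phi y) = y) ->
  (forall x, range phi x -> {for x, continuous rho}) ->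
  acyclic (R := R) [set: T'] -> acyclic (R := R) (range phi).
Proof.
move=> cphi rK crho aT c coc.
have /aT[H pH] : local_cocycle [set: T'] (fun y z => c (phi y) (phi z)).
  move=> y _; have := coc (phi y) (ex_intro2 _ _ y I erefl).
  move/cphi; rewrite nbhs_simpl/=; apply: filterS => z.
  move=> /(_ (ex_intro2 _ _ z I erefl))/(cphi z); rewrite nbhs_simpl/=.
  by move=> h _; apply: filterS h => w /(_ (ex_intro2 _ _ w I erefl)) h _.
exists (H \o rho) => _ [y _ <-] /=.
have h : rho @ phi y --> rho (phi y) := crho _ (ex_intro2 _ _ y I erefl).
have n : nbhs (rho (phi y))
    [set z | [set: T'] z -> H z - H y = c (phi y) (phi z)].
  by rewrite rK; exact: pH.
have hn : nbhs (phi y)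
    (rho @^-1` [set z | [set: T'] z -> H z - H y = c (phi y) (phi z)]) := h _ n.
by apply: filterS hn => w + [z _ wE]; rewrite -wE /= !rK; exact.
Qed.

Lemma closed_point (x : space3 R) : closed [set x].
Proof. exact/accessible_closed_set1/hausdorff_accessible/norm_hausdorff. Qed.

Lemma near_neq (x y : space3 R) : x <> y -> \forall w \near x, w <> y.
Proof.
move=> xy; have xy' : ~ [set y] x by [].
by have := closed_escape (closed_point (x := y)) xy'; exact.
Qed.

Lemma sphere_minus_acyclic (u : space3 R) : sphere u ->
  acyclic (R := R) (@sphere R `\ u).
Proof.
move=> /sphereE uu; have [a [b abu]] := frame_exists uu.
rewrite -(unstereo_range abu).
apply: (@acyclic_homeo _ _ (unstereo a b u) (stereo a b u)).
- exact: unstereo_continuous.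
- exact: unstereoK.
- rewrite unstereo_range// => x [Sx xu]; apply: stereo_continuous.
  by apply/negP => /eqP E; have := sphere_dot_lt1 Sx _ xu; rewrite E ltxx;
    move=> /(_ (iffRL (sphereE _) uu)).
- exact: plane_acyclic.
Qed.

(** The complex exponential followed by inverse stereographic projection maps the plane onto the
    sphere without two opposite points. *)
Lemma sphere_minus2_lc_connected (u : space3 R) : sphere u ->
  lc_connected (R := R) ((@sphere R `\ u) `&` (@sphere R `\ - u)).
Proof.
move=> Su; have [a [b abu]] := frame_exists (iffLR (sphereE _) Su).
pose P (p : R * R) := (expR p.1 * cos p.2, expR p.1 * sin p.2).
have cP : continuous P.
  have c1 : continuous (fun p : R * R => expR p.1).
    move=> p; apply: continuous_comp; [exact: cvg_fst|exact: continuous_expR].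
  have c2 (f : R -> R) : continuous f -> continuous (fun p : R * R => f p.2).
    by move=> cf p; apply: continuous_comp; [exact: cvg_snd|exact: cf].
  have c3 f : continuous f -> continuous (fun p : R * R => expR p.1 * f p.2).
    by move=> cf p; apply: cvgM; [exact: c1|exact: c2].
  move=> p; apply: (@continuous_pair (R * R)%type R R) ;
    apply: c3; [exact: continuous_cos|exact: continuous_sin].
suff <- : range (unstereo a b u \o P) =
    (@sphere R `\ u) `&` (@sphere R `\ - u).
  apply: lc_connected_image; last exact: plane_lc_connected.
  by move=> p; apply: continuous_comp; [exact: cP|exact: unstereo_continuous].
apply/seteqP; split => [_ [p _ <-]|x [[Sx xu] [_ xNu]]] /=.
- split; split; try exact: unstereo_sphere; first exact: unstereo_neq.
  move=> E; have := unstereoK abu (P p); rewrite E /stereo !dotE.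
  case: abu => -[_ _ _] _ au bu; rewrite (dotC u a) (dotC u b) au bu oppr0 !mul0r.
  case=> e1 e2; have := cos2Dsin2 p.2; have := expR_gt0 p.1.
  move: e1 e2 => /esym/eqP + /esym/eqP; rewrite !mulf_eq0 => + + p0.
  rewrite !(gt_eqF p0)/= => /eqP -> /eqP ->; rewrite expr0n addr0.
  by move=> /eqP; rewrite eq_sym oner_eq0.
- have /polar[r [th [e1 e2]]] :
      ((stereo a b u x).1, (stereo a b u x).2) <> (0, 0).
    by rewrite -surjective_pairing => /(stereo_eq0 abu Sx xu).
  by exists (r, th) => //=; rewrite /P/= -e1 -e2 -surjective_pairing stereoK.
Qed.

(** Mayer-Vietoris for the complements of two opposite points, each of which is a plane. *)
Lemma sphere_acyclic : acyclic (R := R) (@sphere R).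
Proof.
move=> c coc; have e0 : dot (vec3 1 0 0 : space3 R) (vec3 1 0 0) = 1.
  by rewrite dot_vec3 !mxE/=; ring.
pose u : space3 R := vec3 1 0 0.
have Su : sphere u by apply/sphereE.
have [a [b abu]] := frame_exists e0.
have sub v : local_cocycle (@sphere R `\ v) c.
  move=> x [Sx _]; apply: filterS (coc x Sx) => z + [Sz _].
  by move=> /(_ Sz); apply: filterS => w + [Sw _]; exact.
have [H1 p1] := sphere_minus_acyclic Su (sub u).
have [H2 p2] := sphere_minus_acyclic (sphere_opp Su) (sub (- u)).
have uN : u <> - u.
  by move=> E; have := e0; rewrite -/u {1}E dotNl e0; lra.
have -> : @sphere R = (@sphere R `\ u) `|` (@sphere R `\ - u).
  apply/seteqP; split => [x Sx|x []]; try by case.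
  have [->|xu] := pselect (x = u); [right|left]; by split.
case: abu => -[aa _ _] _ au _.
have Sa : sphere a by apply/sphereE.
apply: (@primitive_glue _ _ _ _ c H1 H2 a) => //.
- by split=> // E; move: au; rewrite E -/u e0; lra.
- by split=> // E; move: au; rewrite E dotNl -/u e0; lra.
- exact: sphere_minus2_lc_connected.
- move=> x [Sx xu] nx; have : \forall w \near x, w <> u by exact: near_neq.
  by apply: filterS => w wu [].
- move=> x [Sx xu] nx; have : \forall w \near x, w <> - u by exact: near_neq.
  by apply: filterS => w wu [].
Qed.

(** Connected sets are used instead of paths because faces are defined as connected components. *)
Definition joined (D : set (space3 R)) (p q : space3 R) :=
  exists C, [/\ connected C, C `<=` D, C p & C q].

Lemma joinedC D p q : joined D p q -> joined D q p.
Proof. by move=> [C [cC CD Cp Cq]]; exists C. Qed.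

Lemma joined_trans D p q r : joined D p q -> joined D q r -> joined D p r.
Proof.
move=> [C [cC CD Cp Cq]] [C' [cC' C'D C'q C'r]]; exists (C `|` C'); split.
- by apply: connectedU => //; exists q.
- by move=> x [/CD|/C'D].
- by left.
- by right.
Qed.

Lemma joined_locally_constant U D (f : space3 R -> U) p q :
  joined D p q -> locally_constant D f -> f p = f q.
Proof.
move=> [C [cC CD Cp Cq]] lf; apply: (connected_locally_constant cC) => //.
by move=> x /CD/lf; apply: filterS => w + /CD.
Qed.

Lemma segment_image (T : topologicalType) (f : R * R -> T) (p q : R * R) :
  continuous f -> exists C, [/\ compact C, connected C, C (f p), C (f q) &
    forall x, C x -> exists2 t, 0 <= t <= 1 &
      x = f (p.1 + t * (q.1 - p.1), p.2 + t * (q.2 - p.2))].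
Proof.
move=> cf; pose g (t : R) := f (p.1 + t * (q.1 - p.1), p.2 + t * (q.2 - p.2)).
have cg : continuous g.
  move=> t; apply: (@continuous_comp _ _ _ (fun t => (_, _)) f).
    exact: segment_continuous.
  exact: cf.
exists (g @` `[0, 1]); split.
- by apply: continuous_compact; [exact: continuous_subspaceT|exact: segment_compact].
- apply: connected_continuous_connected; first exact: segment_connected.
  exact: continuous_subspaceT.
- exists 0; first by rewrite /= in_itv/= lexx ler01.
  by rewrite /g !mul0r !addr0 -surjective_pairing.
- exists 1; first by rewrite /= in_itv/= lexx ler01.
  by rewrite /g !mul1r !(addrC _ (_ - _)) !subrK -surjective_pairing.
- by move=> _ [t /= + <-]; rewrite in_itv/= => t01; exists t.
Qed.

Lemma sphere_minus_joined (z p q : space3 R) :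
  sphere z -> sphere p -> sphere q -> p <> z -> q <> z ->
  exists C, [/\ compact C, connected C, C `<=` @sphere R `\ z, C p & C q].
Proof.
move=> Sz Sp Sq pz qz; have [a [b abz]] := frame_exists (iffLR (sphereE _) Sz).
have [C [kC cC Cp Cq Cin]] :=
  segment_image (stereo a b z p) (stereo a b z q)
    (unstereo_continuous (a := a) (b := b) (u := z)).
rewrite !stereoK// in Cp Cq; exists C; split=> //.
by rewrite -(unstereo_range abz) => x /Cin[t _ ->]; eexists.
Qed.

(** In the chart projecting from [- x], the point [x] is the origin, and a ball around the origin
    contains the segment from it to each of its points. *)
Lemma sphere_locally_joined (x : space3 R) U : sphere x -> nbhs x U ->
  \forall w \near x, sphere w -> joined (@sphere R `&` U) x w.
Proof.
move=> Sx xU; have [a [b abx]] := frame_exists (iffLR (sphereE _) (sphere_opp Sx)).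
have xN : x <> - x.
  move=> E; have /sphereE := Sx; rewrite {1}E dotNl => h.
  by have := dot_ge0 x; lra.
have sx : stereo a b (- x) x = (0, 0).
  rewrite /stereo; case: abx => _ _; rewrite !dotNr => /eqP + /eqP.
  by rewrite !oppr_eq0 !(dotC _ x) => /eqP -> /eqP ->; rewrite !mul0r.
have : nbhs (stereo a b (- x) x) (unstereo a b (- x) @^-1` U).
  by apply: (unstereo_continuous (a := a) (b := b) (u := - x)); rewrite stereoK.
rewrite sx => /nbhs_ballP[d /= d0 Bd].
have : \forall w \near x, ball (stereo a b (- x) x) d (stereo a b (- x) w).
  apply: (stereo_continuous (a := a) (b := b) (u := - x)); last exact: nbhsx_ballx.
  by rewrite dotNr (iffLR (sphereE _) Sx) -subr_eq0; apply/eqP; lra.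
have nN := near_neq xN.
apply: filterS2 nN => w wN; rewrite sx => -[w1 w2] Sw.
have [C [kC cC Cp Cq Cin]] :=
  segment_image (stereo a b (- x) x) (stereo a b (- x) w)
    (unstereo_continuous (a := a) (b := b) (u := - x)).
rewrite !stereoK// in Cp Cq; exists C; split=> //.
move=> y /Cin[t /andP[t0 t1] ->]; split; first exact: unstereo_sphere.
apply: Bd; rewrite sx; move: w1 w2.
rewrite /ball/= !sub0r !normrN !add0r !subr0 => w1 w2.
by split; rewrite /ball/= sub0r normrN normrM ger0_norm//;
  [apply: le_lt_trans w1|apply: le_lt_trans w2]; rewrite ler_piMl.
Qed.

Lemma joined_refl (D : set (space3 R)) p : D p -> joined D p p.
Proof. by move=> Dp; exists [set p]; split=> //; [exact: connected1|move=> _ ->]. Qed.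

Lemma joined_near_closed (A : set (space3 R)) (x : space3 R) :
  closed A -> sphere x -> ~ A x ->
  \forall w \near x, sphere w -> joined (@sphere R `\` A) x w.
Proof.
move=> cA Sx nAx; have := sphere_locally_joined Sx (closed_escape cA nAx).
by apply: filterS => w + Sw; exact.
Qed.

(* The indicator of the component of p off A and B is a transition function
   between the complements of A and B, hence yields a local cocycle on the sphere
   punctured at u.  A primitive of it takes the same value at p and q, which are
   joined off A, and so does its difference with the indicator, since p and q
   are joined off B. *)
Lemma janiszewski (A B : set (space3 R)) (u p q : space3 R) :
  sphere u -> closed A -> closed B -> A `&` B = [set u] ->
  joined (@sphere R `\` A) p q -> joined (@sphere R `\` B) p q ->
  joined (@sphere R `\` (A `|` B)) p q.
Proof.
move=> Su cA cB AB jA jB.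
pose W := @sphere R `\` (A `|` B).
have [Sp nAp] : sphere p /\ ~ A p.
  by case: jA => C [_ CA /CA[]].
have [Sq nAq] : sphere q /\ ~ A q.
  by case: jA => C [_ CA _ /CA[]].
have nBp : ~ B p by case: jB => C [_ CB /CB[]].
have Wp : W p by split=> // -[].
pose Q w := joined W p w.
have QW w : Q w -> W w by move=> [C [_ CW _ /CW]].
have Qlc x : W x -> \forall w \near x, W w -> `[< Q w >] = `[< Q x >].
  move=> [Sx nx]; have := joined_near_closed (closedU cA cB) Sx nx.
  apply: filterS => w + [Sw _] => /(_ Sw) j; apply/asboolP/asboolP => ?.
    exact: joined_trans (joinedC j).
  exact: joined_trans j.
pose chi w : R := `[< Q w >]%:R.
(* A primitive of [c] is locally constant off [A]. Near a point of [A] other than [u] the set [B] is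
   absent and the primitive varies like [chi], which vanishes on [A]; so its difference with [chi]
   is locally constant off [B]. *)
pose c x w : R := if `[< A x >] then chi w else 0.
have Au : A u /\ B u by have : [set u] u by []; rewrite -AB.
have /(sphere_minus_acyclic Su)[H pH] : local_cocycle (@sphere R `\ u) c.
  move=> x [Sx xu]; rewrite /c; case: asboolP => Ax; last first.
    apply: filterS (closed_escape cA Ax) => z Az _.
    by near=> w => _; rewrite asboolF// addr0.
  have nBx : ~ B x by move=> Bx; apply: xu; have : (A `&` B) x by []; rewrite AB.
  apply: filterS (closed_escape cB nBx) => z Bz [Sz zu].
  case: asboolP => Az.
    by near=> w => _; rewrite [chi z]/chi asboolF ?add0r// => /QW[_]; case; left.
  have Wz : W z by split=> // -[].
  move: (Qlc z Wz) (closed_escape cA Az) (closed_escape cB Bz).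
  apply: filterS3 => w + Aw Bw [Sw _]; rewrite addr0 /chi => -> //.
  by split=> // -[].
have Hpq : H p = H q.
  apply: (joined_locally_constant jA) => x [Sx Ax].
  have xu : x <> u by move=> E; apply: Ax; rewrite E; case: Au.
  have := pH x (conj Sx xu); apply: filterS => w + [Sw Aw].
  have wu : w <> u by move=> E; apply: Aw; rewrite E; case: Au.
  by move=> /(_ (conj Sw wu)); rewrite /c asboolF//; lra.
have : H p - chi p = H q - chi q.
  apply: (joined_locally_constant jB (f := fun w => H w - chi w)) => x [Sx Bx].
  have xu : x <> u by move=> E; apply: Bx; rewrite E; case: Au.
  have wu w : ~ B w -> w <> u by move=> Bw E; apply: Bw; rewrite E; case: Au.
  have := pH x (conj Sx xu); rewrite /c; case: asboolP => Ax.
    apply: filterS => w + [Sw Bw]; rewrite [chi x]/chi asboolF.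
      by move=> /(_ (conj Sw (wu w Bw))) /=; lra.
    by move=> /QW[_]; case; left.
  have Wx : W x by split=> // -[].
  move: (Qlc x Wx) (closed_escape cA Ax).
  apply: filterS3 => w + Aw + [Sw Bw] => h1 /(_ (conj Sw (wu w Bw))) h2.
  by rewrite /chi h1; [lra|split=> // -[]].
rewrite Hpq => /eqP; rewrite (inj_eq (addrI _)) eqr_opp /chi.
rewrite asboolT; last exact: joined_refl.
by case: asboolP => // _ /eqP/esym/eqP; rewrite eq_sym oner_eq0.
Unshelve. all: by end_near. Qed.

End Joined.

(** * Arcs and faces of an embedded graph *)

Section Arcs.
Context {R : realType}.
Variable g : R -> space3 R.
Hypothesis cg : {within `[0, 1], continuous g}.

Lemma near_arc t (U : set (space3 R)) : 0 <= t <= 1 -> nbhs (g t) U ->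
  exists2 d, 0 < d & forall s, 0 <= s <= 1 -> `|s - t| < d -> U (g s).
Proof.
move=> t01 Ut; have t01' : t \in `[0, 1] by rewrite in_itv.
have ct : g x @[x --> within `[0, 1] (nbhs t)] --> g t.
  by move/subspace_continuousP : cg; apply.
have : \forall s \near t, `[0, 1]%classic s -> U (g s) := ct _ Ut.
move=> /nbhs_ballP[d /= d0 Bd]; exists d => // s s01 sd.
by apply: (Bd s); rewrite /ball/= ?in_itv// distrC.
Qed.

Lemma arc_segment_compact s r : 0 <= s -> r <= 1 -> compact (g @` `[s, r]).
Proof.
move=> s0 r1; apply: continuous_compact; last exact: segment_compact.
apply: continuous_subspaceW cg => t /=; rewrite !in_itv/= => /andP[? ?].
by apply/andP; split; lra.
Qed.

Lemma arc_segment_closed s r : 0 <= s -> r <= 1 -> closed (g @` `[s, r]).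
Proof.
by move=> s0 r1; apply: compact_closed; [exact: norm_hausdorff|exact: arc_segment_compact].
Qed.

Hypothesis ig : set_inj `[0, 1] g.
Hypothesis sg : forall t, 0 <= t <= 1 -> sphere (g t).

Lemma arc_inj s t : 0 <= s <= 1 -> 0 <= t <= 1 -> g s = g t -> s = t.
Proof. by move=> s01 t01; apply: ig; rewrite inE/= in_itv. Qed.

(** A short piece of the arc around [g t] misses a compact connected set joining [p] to [q] in the
    sphere punctured at [g t]. Consecutive pieces share a single point, so Janiszewski's theorem
    joins them up, and Cousin's lemma concludes. *)
Lemma arc_not_separating s r p q : 0 <= s -> s <= r -> r <= 1 ->
  sphere p -> sphere q -> ~ (g @` `[s, r]) p -> ~ (g @` `[s, r]) q ->
  joined (@sphere R `\` g @` `[s, r]) p q.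
Proof.
move=> s0 sr r1 Sp Sq np nq.
have off t z : ~ (g @` `[s, r]) z -> s <= t <= r -> z <> g t.
  by move=> nz tsr E; apply: nz; exists t; rewrite //= in_itv.
apply: (@cousin _ (fun s r => joined (@sphere R `\` g @` `[s, r]) p q)) => //.
- move=> t tsr; have t01 : 0 <= t <= 1 by case/andP: tsr => ? ?; apply/andP; split; lra.
  have [C [kC cC CS Cp Cq]] := sphere_minus_joined (sg t01) Sp Sq
    (off t p np tsr) (off t q nq tsr).
  have nC : ~ C (g t) by move=> /CS[_]; apply.
  have cC' := compact_closed (@norm_hausdorff _ _) kC.
  have [d d0 dC] := near_arc t01 (closed_escape cC' nC).
  exists d => // a b sa ab br ta tb; exists C; split=> // x Cx; split.
    by have [] := CS x Cx.
  move=> [v /=]; rewrite in_itv/= => /andP[av vb] vx.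
  apply: (dC v); rewrite ?vx//; first by apply/andP; split; lra.
  by rewrite ltr_norml; apply/andP; split; lra.
- move=> a b c sa ab bc cr jab jbc.
  have -> : g @` `[a, c] = g @` `[a, b] `|` g @` `[b, c].
    rewrite -image_setU; congr (_ @` _); apply/seteqP; split => t /=;
      rewrite !in_itv/=.
      by move=> /andP[h1 h2]; have [?|/ltW ?] := leP t b; [left|right];
        apply/andP.
    by move=> [] /andP[h1 h2]; apply/andP; split; lra.
  apply: (@janiszewski _ _ _ (g b)) => //.
  + by apply: sg; apply/andP; split; lra.
  + by apply: arc_segment_closed; lra.
  + by apply: arc_segment_closed; lra.
  + apply/seteqP; split => x /=.
      move=> [[t /=]]; rewrite in_itv/= => /andP[at_ tb] <- [v /=].
      rewrite in_itv/= => /andP[bv vc] E.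
      have tv : v = t by apply: arc_inj => //; apply/andP; split; lra.
      by have -> : t = b by lra.
    by move=> ->; split; exists b; rewrite //= in_itv/= lexx ?andbT.
Qed.

Lemma open_arc_connected : connected (g @` `]0, 1[).
Proof.
apply: connected_continuous_connected.
  by apply/connected_intervalP; exact: interval_is_interval.
apply: continuous_subspaceW cg => t /=; rewrite !in_itv/= => /andP[? ?].
by apply/andP; split; lra.
Qed.

End Arcs.

Lemma closed_fin_bigcup (T : topologicalType) (I : finType) (F : I -> set T) :
  (forall i, closed (F i)) -> closed (\bigcup_i F i).
Proof. by move=> cF; apply: closed_bigcup => //; exact: finite_finset. Qed.

(** * Faces of an embedded graph and their frontiers *)

Section EmbeddedGraph.
Context {R : realType} {V : finType} {e : rel V} (j : embedding R e).

Local Notation K := (embedding_image j).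

Lemma arc_closed u v : e u v -> closed (arc j u v).
Proof. by move=> /(arc_is_arc j)[g [cg _ _ _ ->]]; exact: arc_segment_closed. Qed.

Definition partial_image (P : V -> V -> Prop) : set (space3 R) :=
  range (pt j) `|` [set x | exists u v, [/\ e u v, P u v & arc j u v x]].

Lemma partial_image_closed P : closed (partial_image P).
Proof.
apply: closedU.
  have -> : range (pt j) = \bigcup_u [set pt j u].
    by apply/seteqP; split => [_ [u _ <-]|_ [u _ ->]]; exists u.
  by apply: closed_fin_bigcup => u; exact: closed_point.
pose F (p : V * V) := [set x | [/\ e p.1 p.2, P p.1 p.2 & arc j p.1 p.2 x]].
rewrite (_ : mkset _ = \bigcup_p F p); last first.
  apply/seteqP; split => [x [u [v xuv]]|x [[u v] _ xuv]]; first by exists (u, v).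
  by exists u, v.
apply: closed_fin_bigcup => -[u v]; rewrite /F /=.
have [euv|nuv] := pselect (e u v /\ P u v); last first.
  rewrite (_ : mkset _ = set0); first exact: closed0.
  by apply/seteqP; split => // x [euv Puv _]; case: nuv.
rewrite (_ : mkset _ = arc j u v); first by apply: arc_closed; case: euv.
by apply/seteqP; split => [x []|x] //; case: euv.
Qed.

Lemma embedding_image_closed : closed K.
Proof.
have -> : K = partial_image (fun _ _ => True).
  by congr (_ `|` _); apply/seteqP; split => x [u [v [? ?]]]; exists u, v; split.
exact: partial_image_closed.
Qed.

Lemma face_sub (f : faces j) x : val f x -> sphere x /\ ~ K x.
Proof.
case: f => f /= /set_mem[y _ ->] fx.
by have [] := connected_component_sub fx.
Qed.

Lemma face_connected (f : faces j) : connected (val f).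
Proof. by case: f => f /= /set_mem[y _ ->]; exact: component_connected. Qed.

Lemma face_joined (f : faces j) x y :
  val f x -> joined (@sphere R `\` K) x y -> val f y.
Proof.
case: f => f /= /set_mem[z Wz ->] fx [C [cC CW Cx Cy]].
have -> : connected_component (@sphere R `\` K) z =
    connected_component (@sphere R `\` K) x.
  exact: same_connected_component.
exact: (connected_component_max Cx CW cC).
Qed.

Lemma face_nonempty (f : faces j) : exists x, val f x.
Proof.
case: f => f /= /set_mem[z Wz ->]; exists z; exact: connected_component_refl.
Qed.

Lemma face_inj (f g : faces j) x : val f x -> val g x -> f = g.
Proof.
move=> fx gx; apply: val_inj; apply/seteqP; split => y fy.
  apply: (face_joined gx); exists (val f).
  by split=> //; [exact: face_connected|move=> z /face_sub].
apply: (face_joined fx); exists (val g).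
by split=> //; [exact: face_connected|move=> z /face_sub].
Qed.

Lemma face_exists x : sphere x -> ~ K x -> exists f : faces j, val f x.
Proof.
move=> Sx nKx; have Wx : (@sphere R `\` K) x by [].
have Fx : connected_component (@sphere R `\` K) x \in faces j.
  by apply/mem_set; exists x.
by exists (exist (fun f => f \in faces j) _ Fx); exact: connected_component_refl.
Qed.

Lemma near_face (f : faces j) x : val f x ->
  \forall w \near x, sphere w -> val f w.
Proof.
move=> fx; have [Sx nKx] := face_sub fx.
have := joined_near_closed embedding_image_closed Sx nKx.
by apply: filterS => w + Sw => /(_ Sw); exact: face_joined.
Qed.

Lemma near_not_face (f : faces j) x : sphere x -> ~ K x -> ~ val f x ->
  \forall w \near x, sphere w -> ~ val f w.
Proof.
move=> Sx nKx nfx; have := joined_near_closed embedding_image_closed Sx nKx.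
by apply: filterS => w + Sw fw => /(_ Sw)/joinedC/(face_joined fw).
Qed.

Definition rest u v :=
  partial_image (fun a b => ~ (a = u /\ b = v) /\ ~ (a = v /\ b = u)).

Lemma rest_sub u v : rest u v `<=` K.
Proof. by move=> x [?|[a [b [? _ ?]]]]; [left|right; exists a, b]. Qed.

Lemma rest_cover u v : e u v -> e v u -> K `<=` rest u v `|` arc j u v.
Proof.
move=> euv evu x [?|[a [b [eab xab]]]]; first by left; left.
have [[au bv]|n1] := pselect (a = u /\ b = v); first by right; rewrite -au -bv.
have [[av bu]|n2] := pselect (a = v /\ b = u).
  by right; rewrite arc_sym// -av -bu.
by left; right; exists a, b.
Qed.

Lemma rest_arc u v x : e u v -> rest u v x -> arc j u v x ->
  x = pt j u \/ x = pt j v.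
Proof.
move=> euv + auv; have pw w : x = pt j w -> x = pt j u \/ x = pt j v.
  by move=> E; move: auv; rewrite E => /(arc_pt euv)[->|->]; [left|right].
case=> [[w _ /esym/pw//]|[a [b [eab [n1 n2] aab]]]].
by have [h|[h1 h2]|[w /pw//]] := arc_meet eab euv aab auv; tauto.
Qed.

Lemma subinterval (s d : R) : 0 <= s <= 1 -> 0 < d ->
  exists l r, [/\ 0 < l, l < r, r < 1 &
    forall t, l <= t <= r -> 0 <= t <= 1 /\ `|t - s| < d].
Proof.
move=> /andP[s0 s1] d0.
have [d' [d'0 d'd d'2]] : exists d', [/\ 0 < d', d' <= d & d' <= 1 / 2].
  have [h|h] := leP d (1 / 2); first by exists d.
  by exists (1 / 2); split; lra.
have [h|h] := leP s (1 / 2).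
  exists (s + d' / 4), (s + d' / 2); split; try lra.
  move=> t /andP[t1 t2]; split; first by apply/andP; split; lra.
  by rewrite ltr_norml; apply/andP; split; lra.
exists (s - d' / 2), (s - d' / 4); split; try lra.
move=> t /andP[t1 t2]; split; first by apply/andP; split; lra.
by rewrite ltr_norml; apply/andP; split; lra.
Qed.

(* If the face f missed part of the arc, f would still be a component after
   removing an open piece of the arc; but what is left of the arc is two
   dangling arcs, which by Janiszewski's theorem separate nothing. *)
Lemma arc_sub_closure u v x (f : faces j) : e u v -> e v u -> arc j u v x ->
  (forall w, x <> pt j w) -> closure (val f) x -> arc j u v `<=` closure (val f).
Proof.
move=> euv evu auvx xpt fx _y; have [g [cg ig g0 g1 Ag]] := arc_is_arc j euv.
have gA t : 0 <= t <= 1 -> arc j u v (g t).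
  by move=> t01; rewrite Ag; exists t; rewrite //= in_itv.
have sg t : 0 <= t <= 1 -> sphere (g t) by move=> /gA; exact: arc_sphere.
have ginj := arc_inj ig.
rewrite {1}Ag => -[s0 /=]; rewrite in_itv/= => s01 <-{_y}.
apply: contrapT => nfs.
have [d d0 nf] := near_arc cg s01 (closed_escape (@closed_closure _ _) nfs).
(* A parameter interval strictly inside (0, 1) whose image avoids the closure of [f]; its interior
   is the piece of arc to be removed. *)
have [l [r [l0 lr r1 lrd]]] := subinterval s01 d0.
have {}nf t : l <= t <= r -> ~ closure (val f) (g t).
  by move=> /lrd[t01 td]; exact: nf.
have [m /andP[lm mr]] : exists m, l < m < r.
  by exists ((l + r) / 2); apply/andP; split; lra.
have {s01 d d0 lrd nfs} [m0 m1] := (lt_trans l0 lm, lt_trans mr r1).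
have [lE0 lE1] := (ltW l0, ltW (lt_trans lm m1)).
have [rE0 rE1] := (ltW (lt_trans m0 mr), ltW r1).
have m01 : 0 <= m <= 1 by rewrite !ltW.
have in01 (a b t : R) : 0 <= a -> b <= 1 -> a <= t -> t <= b -> 0 <= t <= 1.
  by move=> a0 b1 at_ tb; rewrite (le_trans a0 at_) (le_trans tb b1).
have in01W (t : R) : 0 < t < 1 -> 0 <= t <= 1 by move=> /andP[? ?]; rewrite !ltW.
pose K3 := rest u v.
have cK3 : closed K3 by exact: partial_image_closed.
have K3g t : 0 < t < 1 -> ~ K3 (g t).
  move=> t01 /(rest_arc euv) []; first exact/gA/in01W.
    rewrite -g0 => /ginj; rewrite lexx ler01 => /(_ (in01W _ t01) isT) E.
    by rewrite E ltxx in t01.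
  rewrite -g1 => /ginj; rewrite lexx ler01 => /(_ (in01W _ t01) isT) E.
  by rewrite E ltxx andbF in t01.
pose y := g m.
have [q fq] := face_nonempty f.
have [Sq nKq] := face_sub fq.
have nAq : ~ arc j u v q by move=> h; apply: nKq; right; exists u, v.
have Sy : sphere y by exact: sg.
have Sx : sphere x := arc_sphere euv auvx.
have [t0 t01 tx] : exists2 t, 0 < t < 1 & x = g t.
  move: auvx; rewrite {1}Ag => -[t /=]; rewrite in_itv/= => /andP[t0 t1] tx.
  exists t => //; apply/andP; split; rewrite lt_neqAle ?t0 ?t1 andbT; apply/eqP => E.
    by apply: (xpt u); rewrite -tx -E.
  by apply: (xpt v); rewrite -tx E.
have j3 : joined (@sphere R `\` K3) y q.
  apply: (@joined_trans _ _ _ x).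
    exists (g @` `]0, 1[); split; first exact: open_arc_connected.
    + move=> _ [t + <-]; rewrite /= in_itv/= => t01'; split; last exact: K3g.
      exact/sg/in01W.
    + by exists m; rewrite //= in_itv/= m0.
    + by exists t0; rewrite //= in_itv.
  have nK3x : ~ K3 x by rewrite tx; exact: K3g.
  have [w [fw jw]] := fx _ (joined_near_closed cK3 Sx nK3x).
  apply: (@joined_trans _ _ _ w); first by apply: jw; have [] := face_sub fw.
  exists (val f); split=> //; first exact: face_connected.
  by move=> z /face_sub[Sz nKz]; split=> // /rest_sub.
have Dsub a b z : 0 <= a -> b <= 1 -> (g @` `[a, b]) z -> arc j u v z.
  move=> a0 b1 [t /=]; rewrite in_itv/= => /andP[h1 h2] <-.
  by apply: gA; exact: in01 a0 b1 h1 h2.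
have ju : joined (@sphere R `\` g @` `[0, l]) y q.
  apply: (arc_not_separating cg ig sg) => //; last by move=> /Dsub h; exact/nAq/h.
  move=> [t /=]; rewrite in_itv/= => /andP[h1 h2] /ginj E.
  by have := h2; rewrite (E (in01 _ _ _ (lexx 0) lE1 h1 h2) m01) leNgt lm.
have jv : joined (@sphere R `\` g @` `[r, 1]) y q.
  apply: (arc_not_separating cg ig sg) => //; last by move=> /Dsub h; exact/nAq/h.
  move=> [t /=]; rewrite in_itv/= => /andP[h1 h2] /ginj E.
  by have := h1; rewrite (E (in01 _ _ _ rE0 (lexx 1) h1 h2) m01) leNgt mr.
have ptu : K3 (pt j u) by left; exists u.
have ptv : K3 (pt j v) by left; exists v.
(* The two dangling ends are added one at a time; each meets what is already present in one vertex
   only. *)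
have jK : joined (@sphere R `\` (K3 `|` g @` `[0, l] `|` g @` `[r, 1])) y q.
  apply: (@janiszewski _ _ _ (pt j v)) => //.
  - exact: pt_sphere.
  - by apply: closedU => //; exact: arc_segment_closed.
  - exact: arc_segment_closed.
  - apply/seteqP; split => z /=; last first.
      move=> ->; split; first by left.
      by exists 1; rewrite //= in_itv/= rE1 lexx.
    move=> [h1 [t /=]]; rewrite in_itv/= => /andP[rt t1] zt; rewrite -zt.
    have t01' := in01 _ _ _ rE0 (lexx 1) rt t1.
    have /orP[/eqP ->//|tn1] : (t == 1) || (t < 1) by rewrite -le_eqVlt.
    exfalso; case: h1; rewrite -zt.
      by apply: K3g; rewrite tn1 andbT; exact: lt_le_trans (lt_trans m0 mr) rt.
    move=> [t' /=]; rewrite in_itv/= => /andP[h1 h2] /ginj E.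
    have := h2; rewrite (E (in01 _ _ _ (lexx 0) lE1 h1 h2) t01') leNgt.
    by rewrite (lt_le_trans lr rt).
  - apply: (@janiszewski _ _ _ (pt j u)) => //.
    + exact: pt_sphere.
    + exact: arc_segment_closed.
    + apply/seteqP; split => z /=; last first.
        move=> ->; split => //.
        by exists 0; rewrite //= in_itv/= lE0 lexx.
      move=> [h1 [t /=]]; rewrite in_itv/= => /andP[t0' tl] zt; rewrite -zt.
      have /orP[/eqP <-//|tn0] : (0 == t) || (0 < t) by rewrite -le_eqVlt.
      exfalso; move: h1; rewrite -zt; apply: K3g.
      by rewrite tn0 (le_lt_trans tl (lt_trans lm m1)).
(* Once the open piece is removed, membership in [f] is locally constant on the complement of what
   remains. It holds at [q], hence at [y], which lies on the arc. *)
have : `[< val f y >] = `[< val f q >].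
  apply: (joined_locally_constant (f := fun w => `[< val f w >]) jK).
  move=> w [Sw nw].
  have [fw|nfw] := pselect (val f w).
    apply: filterS (near_face fw) => z h [Sz _].
    by rewrite !asboolT//; exact: h.
  have : \forall z \near w, sphere z -> ~ val f z.
    have [Kw|nKw] := pselect (K w); last exact: near_not_face.
    have nfw' : ~ closure (val f) w.
      have [K3w|] := rest_cover euv evu Kw; first by case: nw; left; left.
      rewrite Ag => -[t /=]; rewrite in_itv/= => /andP[h1 h2] wt.
      rewrite -wt; apply: nf; apply/andP; split.
        rewrite leNgt; apply/negP => tl; apply: nw; left; right; exists t => //=.
        by rewrite in_itv/= h1 ltW.
      rewrite leNgt; apply/negP => tl; apply: nw; right; exists t => //=.
      by rewrite in_itv/= h2 ltW.
    apply: filterS (closed_escape (@closed_closure _ _) nfw') => z + _ fz; apply.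
    exact: subset_closure.
  by apply: filterS => z h [Sz _]; rewrite !asboolF//; exact: h.
rewrite asboolF ?asboolT// => fy; have [_] := face_sub fy; apply.
by right; exists u, v; split=> //; exact: gA.
Qed.

End EmbeddedGraph.

(** * Potentials on the graph of squares *)

Lemma set2_eq (T : finType) (u v u' v' : T) :
  [set u; v]%SET = [set u'; v']%SET -> (u = u' /\ v = v') \/ (u = v' /\ v = u').
Proof.
move=> E; have E' : [set u; v]%SET =i [set u'; v']%SET by move=> x; rewrite E.
move: (E' u) (E' v) (E' u') (E' v'); rewrite !inE !eqxx !orbT /=.
move=> /esym/orP[]/eqP uE /esym/orP[]/eqP vE /orP[]/eqP u'E /orP[]/eqP v'E;
  by [left; split; congruence|right; split; congruence].
Qed.

Section Potential.
Context {R : realType} {V : finType} {e : rel V} (j : embedding R e).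
Hypothesis e_sym : symmetric e.

Local Notation K := (embedding_image j).
Local Notation square := (square_vertex j).

Lemma edge_ends (a : edge e) : exists u v, e u v /\ val a = [set u; v]%SET.
Proof.
case: a => p /=; rewrite inE => /existsP[u /existsP[v /andP[euv /eqP ->]]].
by exists u, v.
Qed.

Lemma edge_other_end (a : edge e) v : v \in val a ->
  exists2 u, e v u & val a = [set v; u]%SET.
Proof.
have [u [w [euw ->]]] := edge_ends a.
rewrite !inE => /orP[/eqP ->|/eqP ->]; first by exists w.
by exists u; rewrite 1?e_sym// finset.setUC.
Qed.

Lemma edge_of u v : e u v -> exists a : edge e, val a = [set u; v]%SET.
Proof.
move=> euv; have h : [set u; v]%SET \in edge_set e.
  by rewrite inE; apply/existsP; exists u; apply/existsP; exists v; rewrite euv/=.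
by exists (exist (fun p => p \in edge_set e) _ h).
Qed.

Lemma edge_imageE (a : edge e) u v : e u v -> val a = [set u; v]%SET ->
  edge_image j a = arc j u v.
Proof.
move=> euv av; apply/seteqP; split => [x [u' [v' []]]|x xuv]; last by exists u, v.
rewrite av => e' /esym/set2_eq[[-> ->]//|[<- <-]].
by rewrite arc_sym// e_sym.
Qed.

Lemma edge_vertex_on_face (a : edge e) v (f : faces j) :
  v \in val a -> edge_on_face a f -> vertex_on_face v f.
Proof.
move=> /edge_other_end[u evu av]; apply; rewrite (edge_imageE evu av).
have [g [_ _ <- _ ->]] := arc_is_arc j evu; exists 0 => //=.
by rewrite in_itv/= lexx ler01.
Qed.

(** The cell decomposition of the sphere given by [j], with vertices, faces and open edges indexed
    by the vertices of the graph of squares. *)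
Definition in_cell (x : space3 R) (c : square) : Prop :=
  match c with
  | SqV v => x = pt j v
  | SqF f => val f x
  | SqE a => edge_image j a x /\ forall v, x <> pt j v
  end.

Lemma in_cell_sphere x c : in_cell x c -> sphere x.
Proof.
case: c => [v ->|f /face_sub[]//|a [[u [v [euv _ h]]] _]].
  exact: pt_sphere.
exact: arc_sphere h.
Qed.

Lemma edge_image_sub (a : edge e) : edge_image j a `<=` K.
Proof. by move=> x [u [v [euv _ h]]]; right; exists u, v. Qed.

Lemma in_cell_unique x c c' : in_cell x c -> in_cell x c' -> c = c'.
Proof.
have ptK v : K (pt j v) by left; exists v.
case: c c' => [v|f|a] [v'|f'|a'] //=.
- by move=> -> /(@pt_inj _ _ _ j) ->.
- by move=> -> /face_sub[_]; case.
- by move=> xv [_ /(_ v)].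
- by move=> + xv; rewrite xv => /face_sub[_]; case.
- by move=> fx f'x; congr SqF; exact: face_inj fx f'x.
- by move=> /face_sub[_ nK] [/edge_image_sub].
- by move=> [_ h] /h.
- by move=> [/edge_image_sub ? _] /face_sub[].
- move=> [[u [v [euv au xuv]]] xp] [[u' [v' [eu'v' a'u xu'v']]] _].
  congr SqE; apply: val_inj; rewrite au a'u.
  have [[-> ->]//|[-> ->]|[w /xp//]] := arc_meet euv eu'v' xuv xu'v'.
  exact: finset.setUC.
Qed.

Lemma in_cell_exists x : sphere x -> exists c, in_cell x c.
Proof.
move=> Sx; have [[[v _ <-]|[u [v [euv xuv]]]]|nKx] := pselect (K x).
- by exists (SqV j v).
- have [[w ->]|xp] := pselect (exists w, x = pt j w); first by exists (SqV j w).
  have [a av] := edge_of euv; exists (SqE j a); split; first by exists u, v.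
  by move=> w xw; apply: xp; exists w.
- by have [f fx] := face_exists Sx nKx; exists (SqF f).
Qed.

Lemma edge_interior (a : edge e) : exists g : R -> space3 R, [/\ {within `[0, 1], continuous g},
  set_inj `[0, 1] g, [set x | in_cell x (SqE j a)] = g @` `]0, 1[ &
  exists u v, [/\ val a = [set u; v]%SET, g 0 = pt j u & g 1 = pt j v]].
Proof.
have [u [v [euv av]]] := edge_ends a.
have [g [cg ig g0 g1 Ag]] := arc_is_arc j euv.
have ginj := arc_inj ig.
exists g; split=> //; last by exists u, v.
apply/seteqP; split => x /=; rewrite (edge_imageE euv av).
  move=> [+ xp]; rewrite {1}Ag => -[t /=]; rewrite in_itv/= => /andP[t0 t1] tx.
  exists t => //=; rewrite in_itv/= !lt_neqAle t0 t1 !andbT.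
  by apply/andP; split; apply/eqP => E;
    [apply: (xp u); rewrite -tx -E|apply: (xp v); rewrite -tx E].
move=> [t /=]; rewrite in_itv/= => /andP[t0 t1] <-.
have t01 : 0 <= t <= 1 by rewrite !ltW.
have gt : arc j u v (g t) by rewrite Ag; exists t; rewrite //= in_itv.
split=> // w E; have hw : arc j u v (pt j w) by rewrite -E.
have [wE|wE] := arc_pt euv hw; move: E; rewrite wE.
  rewrite -g0 => /ginj; rewrite lexx ler01 => /(_ t01 isT) E.
  by rewrite E ltxx in t0.
rewrite -g1 => /ginj; rewrite lexx ler01 => /(_ t01 isT) E.
by rewrite E ltxx in t1.
Qed.

Lemma cell_connected c : connected [set x | in_cell x c].
Proof.
case: c => [v|f|a]; [exact: connected1|exact: face_connected|].
by have [g [cg _ -> _]] := edge_interior a; exact: open_arc_connected.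
Qed.

Lemma cell_nonempty c : exists x, in_cell x c.
Proof.
case: c => [v|f|a]; [by exists (pt j v)|exact: face_nonempty|].
have [g [_ _ E _]] := edge_interior a; exists (g (1 / 2)).
suff : [set x | in_cell x (SqE j a)] (g (1 / 2)) by [].
by rewrite E; exists (1 / 2) => //=; rewrite in_itv/=; apply/andP; split; lra.
Qed.

Lemma vertex_edge_closure (a : edge e) v : v \in val a ->
  closure [set x | in_cell x (SqE j a)] (pt j v).
Proof.
have [g [cg _ -> [u [w [-> g0 g1]]]]] := edge_interior a.
have nearg (t : R) : 0 <= t <= 1 -> closure (g @` `]0, 1[) (g t).
  move=> t01 U Ut; have [d d0 dU] := near_arc cg t01 Ut.
  have [l [r [l0 lr r1 lrd]]] := subinterval t01 d0.
  have [|h1 h2] := lrd l; first by rewrite lexx ltW.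
  exists (g l); split; last exact: dU.
  by exists l => //=; rewrite in_itv/= l0/=; exact: lt_trans r1.
by rewrite !inE => /orP[]/eqP ->; [rewrite -g0|rewrite -g1]; apply: nearg;
  rewrite lexx ler01.
Qed.

Lemma edge_side (a : edge e) (f : faces j) x : in_cell x (SqE j a) ->
  closure (val f) x -> edge_on_face a f.
Proof.
have [u [v [euv av]]] := edge_ends a; have evu : e v u by rewrite e_sym.
move=> [xa xp] fx y ya; split; last by move=> /face_sub[_]; apply; exact: edge_image_sub ya.
rewrite (edge_imageE euv av) in xa ya.
exact: arc_sub_closure euv evu xa xp fx y ya.
Qed.

(** An upper bound for the relation that [c] meets the closure of [c']. Every vertex is put below
    every face, since only a necessary condition on nearby cells is wanted. *)
Definition below (c c' : square) : Prop :=
  c' = c \/ match c, c' with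
            | SqV v, SqE a => v \in val a
            | SqE a, SqF f => edge_on_face a f
            | SqV _, SqF _ => True
            | _, _ => False
            end.

Variables (I : finType) (face_of : I -> faces j).
Hypothesis face_of_surj : forall f, exists i, face_of i = f.

(** A cell whose closure misses [x] stays away from [x]. There are finitely many cells, the faces
    being enumerated by [I], so one neighbourhood works for all; for the faces near an edge point
    this rests on [edge_side]. *)
Lemma near_below x c : in_cell x c ->
  \forall z \near x, forall c', in_cell z c' -> below c c'.
Proof.
move=> xc; have Sx := in_cell_sphere xc.
have FF : Filter (nbhs x) by exact: nbhs_filter.
have nV : \forall z \near x, forall w, z = pt j w -> x = pt j w.
  apply: (@filter_forall _ V (fun w z => z = pt j w -> x = pt j w) (nbhs x) FF) => w.
  have [E|/near_neq E] := pselect (x = pt j w).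
    by apply: filterE.
  by apply: filterS E => z zw /zw.
have nE : \forall z \near x, forall p : V * V,
    e p.1 p.2 -> arc j p.1 p.2 z -> arc j p.1 p.2 x.
  apply: (@filter_forall _ (V * V)%type (fun p z => e p.1 p.2 ->
    arc j p.1 p.2 z -> arc j p.1 p.2 x) (nbhs x) FF) => p.
  have [E|E] := pselect (e p.1 p.2 -> arc j p.1 p.2 x).
    by apply: filterE => z /E.
  have [ep nx] : e p.1 p.2 /\ ~ arc j p.1 p.2 x.
    by split; [apply: contrapT => h|move=> h]; apply: E => //.
  by apply: filterS (closed_escape (arc_closed ep) nx) => z nz _ /nz.
have nF : \forall z \near x, forall i, val (face_of i) z ->
    closure (val (face_of i)) x.
  apply: (@filter_forall _ I (fun i z => val (face_of i) z ->
    closure (val (face_of i)) x) (nbhs x) FF) => i.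
  have [E|E] := pselect (closure (val (face_of i)) x); first by apply: filterE.
  apply: filterS (closed_escape (@closed_closure _ _) E) => z nz fz.
  by case: nz; exact: subset_closure.
case: c xc => [v|f|a] xc.
- move: nV nE; apply: filterS2 => z hV hE [w|f|a] zc; [|by right|].
    by left; congr SqV; apply: (@pt_inj _ _ _ j); rewrite -(hV w zc).
  right; move: zc => -[[u [w [euw -> zuw]]] zp] /=.
  have := hE (u, w) euw zuw; rewrite /= xc => /(arc_pt euw)[->|->];
    by rewrite !inE eqxx ?orbT.
- have := near_face xc; apply: filterS => z fz c' zc'; left.
  by apply: (in_cell_unique zc'); apply: fz; exact: in_cell_sphere zc'.
- move: nV nE nF; apply: filterS3 => z hV hE hF [w|f|b] zc.
  + by have := hV w zc; case: xc => _ /(_ w).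
  + right; have [i fi] := face_of_surj f; rewrite -fi in zc *.
    exact: edge_side xc (hF i zc).
  + left; case: zc => -[u [w [euw bw zuw]]] zp.
    have := hE (u, w) euw zuw => /= xuw.
    apply: (@in_cell_unique x) => //; split; last by case: xc.
    by exists u, w.
Qed.

(** [D c a] is a prescribed increment from [c] to [a]; [quad] closes the increments up around each
    quadrilateral (v, a, f, b). *)
Variable D : square -> edge e -> R.
Hypothesis quad : forall v (f : faces j) (a b : edge e),
  v \in val a -> v \in val b -> edge_on_face a f -> edge_on_face b f ->
  D (SqV j v) a - D (SqF f) a = D (SqV j v) b - D (SqF f) b.

Let incr (c c' : square) : R :=
  match c, c' with
  | SqV v, SqE a => D (SqV j v) a
  | SqE a, SqF f => - D (SqF f) a
  | SqV v, SqF f =>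
    (* by [quad], the choice of the edge is immaterial *)
    match pselect (exists a : edge e, v \in val a /\ edge_on_face a f) with
    | left h => D (SqV j v) (projT1 (cid h)) - D (SqF f) (projT1 (cid h))
    | right _ => 0
    end
  | _, _ => 0
  end.

Let incr_refl c : incr c c = 0.
Proof. by case: c. Qed.

Let incr_trans c c' c'' : below c c' -> below c' c'' ->
  incr c c'' = incr c c' + incr c' c''.
Proof.
move=> [->|h1]; first by rewrite incr_refl add0r.
move=> [->|]; first by rewrite incr_refl addr0.
case: c c' c'' h1 => [v|f|a] [v'|f'|a'] [v''|f''|a''] //= va af.
case: pselect => [h|[]]; last by exists a'.
by case: (cid h) => b [vb bf] /=; apply: quad.
Qed.

(** The increments [incr] between the cells of nearby points form a local cocycle on the sphere. A
    primitive of it is constant on each cell, cells being connected, and its values there are the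
    potential. *)
Lemma square_potential : exists h : square -> R, forall c a,
  square_adj j c (SqE j a) -> D c a = h (SqE j a) - h c.
Proof.
have [c0 _] : exists c0, in_cell (vec3 1 0 0) c0.
  by apply: in_cell_exists; apply/sphereE; rewrite dot_vec3 !mxE/=; ring.
have /choice[k pk] : forall x, exists c, sphere x -> in_cell x c.
  move=> x; have [Sx|nSx] := pselect (sphere x); last by exists c0.
  by have [c xc] := in_cell_exists Sx; exists c.
have kE x c : in_cell x c -> k x = c.
  by move=> xc; apply: (in_cell_unique _ xc); apply: pk; exact: in_cell_sphere xc.
have [x Sx|H pH] := @sphere_acyclic R (fun x w => incr (k x) (k w)).
  apply: filterS (near_below (pk x Sx)) => z bz Sz.
  apply: filterS (near_below (pk z Sz)) => w bw Sw.
  by apply: incr_trans; [exact: bz (pk z Sz)|exact: bw (pk w Sw)].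
have Hc c x y : in_cell x c -> in_cell y c -> H x = H y.
  move=> xc yc; have lH : locally_constant [set x | in_cell x c] H; last first.
    have h := connected_locally_constant (@cell_connected c) lH.
    exact: h x y xc yc.
  move=> z zc; have := pH z (in_cell_sphere zc).
  apply: filterS => w + wc => /(_ (in_cell_sphere wc)).
  by rewrite (kE z c zc) (kE w c wc) incr_refl => /eqP; rewrite subr_eq0 => /eqP.
have /choice[r pr] : forall c, exists x, in_cell x c by exact: cell_nonempty.
have step c c' x : in_cell x c -> closure [set y | in_cell y c'] x ->
    H (r c') - H (r c) = incr c c'.
  move=> xc /(_ _ (pH x (in_cell_sphere xc)))[y [/= yc' h]].
  rewrite (Hc c' _ y (pr c') yc') (Hc c _ x (pr c) xc) (h (in_cell_sphere yc')).
  by rewrite (kE x c)// (kE y c').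
exists (H \o r) => -[v|f|b] a //= inc.
  by rewrite (step (SqV j v) (SqE j a) (pt j v))//; exact: vertex_edge_closure.
have [x xa] := cell_nonempty (SqE j a).
have := step (SqE j a) (SqF f) x xa.
suff h : closure (val f) x by move=> /(_ h) /=; lra.
by move: inc => /asboolP /(_ x (proj1 xa)) [].
Qed.

End Potential.

(** * Angles and turning along paths *)

Section Angles.
Context {R : realType}.
Implicit Types (p q : R * R) (al be ga : R).

Definition is_angle p al :=
  exists2 r, 0 < r & p = (r * cos al, r * sin al).

Lemma angle_exists p : p <> (0, 0) -> exists al, is_angle p al.
Proof.
by case: p => s t /polar[r [al [-> ->]]]; exists al, (expR r); rewrite ?expR_gt0.
Qed.

Lemma angle_scale k p al : 0 < k -> is_angle p al -> is_angle (k * p.1, k * p.2) al.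
Proof.
move=> k0 [r r0 ->]; exists (k * r); first exact: mulr_gt0.
by rewrite /= !mulrA.
Qed.

Lemma angle_eq p al be : is_angle p al -> is_angle p be ->
  cos al = cos be /\ sin al = sin be.
Proof.
move=> [r r0 ->] [s s0 [E1 E2]].
have rs : r = s.
  have : r ^+ 2 = s ^+ 2.
    rewrite -[LHS]mulr1 -[RHS]mulr1 -{1}(cos2Dsin2 al) -(cos2Dsin2 be).
    by rewrite !mulrDr -!exprMn E1 E2.
  by move/eqP; rewrite eqrXn2// ?ltW// => /eqP.
rewrite rs in E1 E2; have s1 : s != 0 by rewrite gt_eqF.
by split; [apply: (mulfI s1)|apply: (mulfI s1)].
Qed.

Lemma angle_shift p q al be ga : is_angle p al -> is_angle p be ->
  is_angle q ga -> is_angle q (ga + (al - be)).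
Proof.
move=> pa pb [r r0 ->]; have [c s] := angle_eq pa pb; exists r => //.
have c1 : cos (al - be) = 1 by rewrite cosB c s -!expr2 cos2Dsin2.
have s1 : sin (al - be) = 0 by rewrite sinB c s; ring.
by rewrite cosD c1 s1 sinD c1 s1; congr pair; ring.
Qed.

Lemma angle_discrete p q al be al' be' : is_angle p al -> is_angle p be ->
  is_angle q al' -> is_angle q be' ->
  `|(al - be) - (al' - be')| < pi -> al - be = al' - be'.
Proof.
move=> pa pb qa qb; have [c s] := angle_eq pa pb; have [c' s'] := angle_eq qa qb.
have s1 : sin (al - be) = 0 by rewrite sinB c s; ring.
have s1' : sin (al' - be') = 0 by rewrite sinB c' s'; ring.
set x := al - be in s1 *; set y := al' - be' in s1' *.
have sxy : sin (x - y) = 0 by rewrite sinB s1 s1'; ring.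
rewrite ltr_norml => /andP[h1 h2].
have [xy|xy|//] := ltgtP x y.
  have := @sin_gt0_pi R (y - x).
  rewrite -opprB sinN sxy oppr0 ltxx => h.
  by suff : false by []; apply: h; apply/andP; split; lra.
have := @sin_gt0_pi R (x - y); rewrite sxy ltxx => h.
by suff : false by []; apply: h; apply/andP; split; lra.
Qed.

Lemma angle_opp p al be : is_angle p al -> is_angle (- p.1, - p.2) be ->
  cos (be - al) < 0.
Proof.
move=> [r r0 ->] [s s0 /= [E1 E2]].
suff : 0 < - cos (be - al) by rewrite oppr_gt0.
rewrite -(pmulr_rgt0 _ s0) cosB.
rewrite (_ : s * _ = - ((s * cos be) * cos al + (s * sin be) * sin al)); last ring.
rewrite -E1 -E2 (_ : - _ = r * (cos al ^+ 2 + sin al ^+ 2)); last ring.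
by rewrite cos2Dsin2 mulr1.
Qed.

Definition pdot p q := p.1 * q.1 + p.2 * q.2.
Definition pcross p q := p.1 * q.2 - p.2 * q.1.

(** The signed angle from [p] to [q], meaningful when [pdot p q] is positive. *)
Definition turn p q : R := atan (pcross p q / pdot p q).

Lemma angle_turn p q al : 0 < pdot p q -> is_angle p al ->
  is_angle q (al + turn p q).
Proof.
move=> d0 [r r0 pE]; rewrite /turn; set t := _ / _.
have ct : 0 < cos (atan t).
  by rewrite cos_atan invr_gt0 sqrtr_gt0; have := sqr_ge0 t; lra.
have st : sin (atan t) = t * cos (atan t).
  by rewrite -{2}(atanK t) /tan divfK// gt_eqF.
exists (pdot p q / (r * cos (atan t))).
  by rewrite divr_gt0// mulr_gt0.
have r1 : r != 0 by rewrite gt_eqF.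
have ct1 : cos (atan t) != 0 by rewrite gt_eqF.
have d1 : pdot p q != 0 by rewrite gt_eqF.
rewrite cosD sinD st; move: (cos (atan t)) ct1 => c c1.
have tE : t * pdot p q = pcross p q by rewrite /t divfK.
have -> : pdot p q / (r * c) * (cos al * c - sin al * (t * c)) =
   (pdot p q * cos al - (t * pdot p q) * sin al) / r by field; apply/andP.
have -> : pdot p q / (r * c) * (sin al * c + cos al * (t * c)) =
   (pdot p q * sin al + (t * pdot p q) * cos al) / r by field; apply/andP.
rewrite tE /pdot /pcross pE /=; case: q {d0 t ct st d1 tE} => u v /=.
congr pair.
  transitivity (u * (cos al ^+ 2 + sin al ^+ 2)); first by rewrite cos2Dsin2 mulr1.
  by field.
transitivity (v * (cos al ^+ 2 + sin al ^+ 2)); first by rewrite cos2Dsin2 mulr1.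
by field.
Qed.

Lemma turn_refl p : turn p p = 0.
Proof. by rewrite /turn /pcross (mulrC p.1) subrr mul0r atan0. Qed.

Lemma turnC p q : turn q p = - turn p q.
Proof.
rewrite /turn -atanN; congr atan; rewrite -mulNr /pcross /pdot; congr (_ / _); ring.
Qed.

Lemma pdot_gt0 p : p <> (0, 0) -> 0 < pdot p p.
Proof.
case: p => s t st0; rewrite /pdot /= -!expr2 lt_neqAle addr_ge0 ?sqr_ge0// andbT.
rewrite eq_sym paddr_eq0 ?sqr_ge0// !sqrf_eq0.
by apply/negP => /andP[/eqP s0 /eqP t0]; rewrite s0 t0 in st0.
Qed.

Lemma turn_small p q : `|turn p q| < pi / 2.
Proof. by rewrite ltr_norml atan_gtNpi2 atan_ltpi2. Qed.

Definition angle_on (T : topologicalType) (A : set T) (f : T -> R * R)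
    (th : T -> R) :=
  (forall x, A x -> is_angle (f x) (th x)) /\
  forall x, A x -> forall d, 0 < d ->
    \forall w \near x, A w -> `|th w - th x| < d.

(** The difference of two angle functions varies continuously among discrete values, hence is
    locally constant. *)
Lemma angle_on_unique (T : topologicalType) (A : set T) f th th' :
  lc_connected (R := R) A -> angle_on A f th -> angle_on A f th' ->
  forall x y, A x -> A y -> th x - th' x = th y - th' y.
Proof.
move=> cA [ath cth] [ath' cth'] x y Ax Ay.
apply: (cA (fun x => th x - th' x)) => // {}x {}Ax.
have p2 : 0 < pi / 2 :> R by rewrite divr_gt0// pi_gt0.
apply: filterS2 (cth x Ax _ p2) (cth' x Ax _ p2) => w h h' Aw.
apply: (@angle_discrete (f w) (f x)); try solve [exact: ath | exact: ath'].
have -> : th w - th' w - (th x - th' x) = (th w - th x) - (th' w - th' x) by ring.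
apply: le_lt_trans (ler_normB _ _) _.
by have := h Aw; have := h' Aw; lra.
Qed.

Lemma angle_onT (T : topologicalType) f (th : T -> R) : continuous th ->
  (forall x, is_angle (f x) (th x)) -> angle_on [set: T] f th.
Proof.
move=> cth ath; split=> [x _ //|x _ d d0].
have /cvgrPdist_lt/(_ d d0) := cth x.
by apply: filterS => w; rewrite distrC.
Qed.

(** * Existence of continuous angle functions *)

Section Lift.
Context {T : topologicalType}.
Variable f : T -> R * R.
Hypothesis cf : continuous f.
Hypothesis f0 : forall x, f x <> (0, 0).

Let c1 : continuous (fun x => (f x).1).
Proof. by move=> x; apply: continuous_comp; [exact: cf|exact: cvg_fst]. Qed.

Let c2 : continuous (fun x => (f x).2).
Proof. by move=> x; apply: continuous_comp; [exact: cf|exact: cvg_snd]. Qed.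

Lemma pdot_continuous p : continuous (fun x => pdot p (f x)).
Proof.
by move=> x; apply: (@continuousD R R T (fun x => p.1 * (f x).1));
  apply: (@continuousM R T (fun=> _)); try exact: cst_continuous;
  [exact: c1|exact: c2].
Qed.

Lemma turn_continuous p x : 0 < pdot p (f x) ->
  {for x, continuous (fun x => turn p (f x))}.
Proof.
move=> d0; apply: (@continuous_comp _ _ _ (fun x => pcross p (f x) / pdot p (f x))).
  apply: (@continuousM R T (fun x => pcross p (f x))).
    by apply: (@continuousB R R T (fun x => p.1 * (f x).2));
      apply: (@continuousM R T (fun=> _)); try exact: cst_continuous;
      [exact: c2|exact: c1].
  apply: (@continuousV R T); last exact: pdot_continuous.
  by rewrite gt_eqF.
exact: continuous_atan.
Qed.

Lemma near_pdot p x : 0 < pdot p (f x) -> \forall w \near x, 0 < pdot p (f w).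
Proof. by move=> d0; apply: (cvgr_gt _ (@pdot_continuous p x)). Qed.

Lemma near_turn x d : 0 < d -> \forall w \near x, `|turn (f x) (f w)| < d.
Proof.
move=> d0; have /cvgrPdist_lt/(_ d d0) := turn_continuous (pdot_gt0 (@f0 x)).
by rewrite turn_refl; apply: filterS => w; rewrite sub0r normrN.
Qed.

Lemma turn_cocycle : local_cocycle [set: T] (fun x w => turn (f x) (f w)).
Proof.
(* Two turns below pi/4 and a direct turn below pi/2 differ by less than the pi allowed by
   [angle_discrete]. *)
have p4 : 0 < pi / 4 :> R by rewrite divr_gt0// pi_gt0.
move=> x _; apply: filterS2 (near_pdot (pdot_gt0 (@f0 x))) (near_turn x p4).
move=> z xz txz _.
apply: filterS3 (near_pdot xz) (near_pdot (pdot_gt0 (@f0 z))) (near_turn z p4).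
move=> w xw zw tzw _.
have [al ax] := angle_exists (@f0 x).
have aw := angle_turn xw ax.
have aw' := angle_turn zw (angle_turn xz ax).
have := angle_discrete aw aw' aw aw; rewrite !subrr subr0.
have -> : al + turn (f x) (f w) - (al + turn (f x) (f z) + turn (f z) (f w)) =
  turn (f x) (f w) - (turn (f x) (f z) + turn (f z) (f w)) by ring.
have t2 := turn_small (f x) (f w).
move=> h; apply/eqP; rewrite -subr_eq0; apply/eqP; apply: h.
apply: le_lt_trans (ler_normB _ _) _.
have := ler_normD (turn (f x) (f z)) (turn (f z) (f w)); lra.
Qed.

(** A primitive of the turns, shifted to be correct at [x0], is correct everywhere, because being an
    angle of [f x] is then a locally constant property. *)
Lemma angle_lift (x0 : T) : acyclic (R := R) [set: T] -> lc_connected (R := R) [set: T] ->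
  exists th, continuous th /\ forall x, is_angle (f x) (th x).
Proof.
move=> aT cT; have [H pH] := aT _ turn_cocycle.
have [al a0] := angle_exists (@f0 x0).
have cH : continuous H.
  move=> x; apply/cvgrPdist_lt => d d0.
  apply: filterS2 (pH x I) (near_turn x d0) => w h.
  by rewrite -h// distrC.
pose P x := is_angle (f x) (H x + (al - H x0)).
exists (fun x => H x + (al - H x0)); split.
  by move=> x; apply: cvgD; [exact: cH|exact: cvg_cst].
move=> x; have : (`[< P x0 >]%:R : R) = `[< P x >]%:R.
  apply: (cT (fun x => `[< P x >]%:R)) => // {}x _.
  apply: filterS2 (near_pdot (pdot_gt0 (@f0 x))) (pH x I) => w dw h _.
  suff E : P w <-> P x by congr (nat_of_bool _)%:R; apply/asboolP/asboolP => /E.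
  have {}h := h I; split; rewrite /P => a.
    have dx : 0 < pdot (f w) (f x) by move: dw; rewrite /pdot !(mulrC (f x).1) !(mulrC (f x).2).
    have := angle_turn dx a; rewrite turnC -h.
    by congr is_angle; ring.
  by have := angle_turn dw a; rewrite -h; congr is_angle; ring.
rewrite asboolT; last by rewrite /P addrC subrK.
by case: asboolP => // _ /eqP; rewrite oner_eq0.
Qed.

End Lift.

Lemma line_lc_connected : lc_connected (R := R) [set: R].
Proof.
apply: path_lc_connected => x y _ _; exists (fun t => x + t * (y - x)).
split=> //; [|by rewrite mul0r addr0|by rewrite mul1r addrC subrK].
move=> t; apply: cvgD; first exact: cvg_cst.
by apply: cvgM; [exact: cvg_id|exact: cvg_cst].
Qed.

Lemma line_angle_unique (f : R -> R * R) th th' :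
  continuous th -> continuous th' ->
  (forall t, is_angle (f t) (th t)) -> (forall t, is_angle (f t) (th' t)) ->
  th 1 - th 0 = th' 1 - th' 0.
Proof.
move=> c c' a a'; have h := angle_on_unique line_lc_connected (angle_onT c a) (angle_onT c' a').
by have := h 0 1 I I; lra.
Qed.

(** The path is viewed as a function on the plane that ignores the second coordinate, so that
    acyclicity of the plane applies. *)
Lemma line_angle_lift (f : R -> R * R) : continuous f ->
  (forall t, f t <> (0, 0)) ->
  exists th, continuous th /\ forall x, is_angle (f x) (th x).
Proof.
move=> cf f0; have [|||//|th [cth ath]] := @angle_lift (R * R)%type (f \o fst) _ _ (0, 0).
- by move=> x; apply: continuous_comp; [exact: cvg_fst|exact: cf].
- by move=> x; exact: f0.
- exact: plane_acyclic.
- exact: plane_lc_connected.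
exists (fun t => th (t, 0)); split=> [t|t]; last exact: (ath (t, 0)).
apply: (@continuous_comp _ _ _ (fun t => (t, 0)) th); last exact: cth.
by apply: (@continuous_pair R R R id (fun=> 0)); [exact: cvg_id|exact: cst_continuous].
Qed.

(** The path [q] runs in [S] from [p] to [p'] with total turning [r]. It is defined on the whole
    line and constant outside [0, 1], which makes concatenation a plain sum. *)
Definition turns (S : set (R * R)) p p' (r : R) :=
  exists (q : R -> R * R) (th : R -> R), [/\ continuous q /\ continuous th,
    forall t, S (q t), forall t, is_angle (q t) (th t),
    [/\ forall t, t <= 0 -> q t = p, forall t, 1 <= t -> q t = p',
       forall t, t <= 0 -> th t = th 0 & forall t, 1 <= t -> th t = th 1] &
    r = th 1 - th 0].

Lemma turns_sub S S' p p' r : S `<=` S' -> turns S p p' r -> turns S' p p' r.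
Proof.
by move=> SS' [q [th [c Sq a e ->]]]; exists q, th; split=> // t; exact: SS'.
Qed.

Lemma turns_rev S p p' r : turns S p p' r -> turns S p' p (- r).
Proof.
move=> [q [th [[cq cth] Sq a [q0 q1 t0 t1] ->]]].
have crev : continuous (fun t : R => 1 - t).
  by move=> t; apply: cvgB; [exact: cvg_cst|exact: cvg_id].
exists (fun t => q (1 - t)), (fun t => th (1 - t)); split=> //.
- by split=> t; (apply: continuous_comp; first exact: crev);
    [exact: cq|exact: cth].
- split=> t ht; try by [apply: q1; lra|apply: q0; lra].
    by rewrite subr0; apply: t1; lra.
  by rewrite subrr; apply: t0; lra.
- by rewrite subrr subr0 opprB.
Qed.

Lemma turns_cat S p p' p'' r r' : turns S p p' r -> turns S p' p'' r' ->
  turns S p p'' (r + r').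
Proof.
move=> [q [th [[cq cth] Sq a [q0 q1 t0 t1] ->]]].
move=> [k [ph [[ck cph] Sk b [k0 k1 s0 s1] ->]]].
have clin (x y : R) : continuous (fun t : R => x * t - y).
  move=> t; apply: cvgB; last exact: cvg_cst.
  by apply: cvgM; [exact: cvg_cst|exact: cvg_id].
(* At each time one of the two paths rests at [p'], so subtracting [p'] leaves the other one, and
   continuity needs no case analysis. *)
pose q' t := q (2 * t - 0) + k (2 * t - 1) - p'.
pose th' t := th (2 * t - 0) + (ph (2 * t - 1) - ph 0).
have lo t : t <= 1 / 2 -> q' t = q (2 * t - 0) /\ th' t = th (2 * t - 0).
  move=> ht; rewrite /q' /th' k0 ?s0; [|lra|lra].
  by rewrite addrK subrr addr0.
have hi t : 1 / 2 <= t -> q' t = k (2 * t - 1) /\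
    th' t = ph (2 * t - 1) + (th 1 - ph 0).
  move=> ht; rewrite /q' /th' q1 ?t1; [|lra|lra].
  by split; [rewrite addrAC subrr add0r|ring].
have ap : is_angle p' (th 1) by rewrite -(q1 1)//; exact: a.
have bp : is_angle p' (ph 0) by rewrite -(k0 0)//; exact: b.
exists q', th'; split.
- split=> t.
    apply: (@continuousB R (R * R)%type R (fun t => q (2 * t - 0) + k (2 * t - 1)));
      last exact: cst_continuous.
    apply: (@continuousD R (R * R)%type R (fun t => q (2 * t - 0))).
      by apply: (@continuous_comp R R (R * R)%type (fun t => 2 * t - 0) q); [exact: clin|exact: cq].
    by apply: (@continuous_comp R R (R * R)%type (fun t => 2 * t - 1) k); [exact: clin|exact: ck].
  apply: (@continuousD R R R (fun t => th (2 * t - 0))).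
    by apply: (@continuous_comp R R R (fun t => 2 * t - 0) th); [exact: clin|exact: cth].
  apply: (@continuousB R R R (fun t => ph (2 * t - 1))); last exact: cst_continuous.
  by apply: (@continuous_comp R R R (fun t => 2 * t - 1) ph); [exact: clin|exact: cph].
- by move=> t; have [/ltW/lo[-> _]|/hi[-> _]] := ltP t (1 / 2).
- move=> t; have [/ltW/lo[-> ->]//|/hi[-> ->]] := ltP t (1 / 2).
  by apply: (angle_shift ap bp); exact: b.
- split=> t ht.
  + by have [|-> _] := lo t; [lra|apply: q0; lra].
  + by have [|-> _] := hi t; [lra|apply: k1; lra].
  + have [|_ ->] := lo t; first lra.
    by have [|_ ->] := lo 0; [lra|rewrite !t0//; lra].
  + have [|_ ->] := hi t; first lra.
    have [|_ ->] := hi 1; first lra.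
    by rewrite s1 1?[in RHS]s1//; lra.
- have [|_ ->] := hi 1; first lra.
  have [|_ ->] := lo 0; first lra.
  by rewrite (s1 (2 * 1 - 1)) ?(t0 (2 * 0 - 0)); [ring|lra|lra].
Qed.

(* The angle Th(t, s) of q(t) + q(s) is symmetric and restricts on the diagonal
   to that of q(t); its increments in t do not depend on s, and vanish when
   q(s) is farthest from the origin, because then q(t) + q(s) stays in the open
   half-plane of q(s). *)
Lemma turns_loop S p r : (forall x y, S x -> S y -> x + y <> (0, 0)) ->
  turns S p p r -> r = 0.
Proof.
move=> nS [q [th [[cq cth] Sq a [q0 q1 _ _] ->]]].
pose G (x : R * R) := q x.1 + q x.2.
have cG : continuous G.
  move=> x; apply: (@continuousD R (R * R)%type (R * R)%type (q \o fst)).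
    by apply: continuous_comp; [exact: cvg_fst|exact: cq].
  by apply: continuous_comp; [exact: cvg_snd|exact: cq].
have G0 x : G x <> (0, 0) by exact: nS.
have [Th [cTh aTh]] := angle_lift cG G0 (0, 0) plane_acyclic plane_lc_connected.
have q01 : q 0 = q 1 by rewrite q0// q1.
have cl (u v : R -> R) : continuous u -> continuous v ->
    continuous (fun t => Th (u t, v t)).
  move=> cu cv t; apply: (@continuous_comp _ _ _ (fun t => (u t, v t)) Th).
    exact: (continuous_pair (cu t) (cv t)).
  exact: cTh.
have cid' : continuous (fun t : R => t) by move=> t; exact: cvg_id.
have cc (z : R) : continuous (fun _ : R => z) by exact: cst_continuous.
have diag : th 1 - th 0 = Th (1, 1) - Th (0, 0).
  apply: (@line_angle_unique (fun t => G (t, t)) th (fun t => Th (t, t))) => //.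
  - exact: cl.
  - move=> t; have := angle_scale (ltr0Sn R 1) (a t); congr is_angle.
    by rewrite /G /= [RHS]surjective_pairing /=; congr pair; ring.
have swap s t : Th (s, t) = Th (t, s).
  have cs : continuous (fun x : R * R => Th (x.2, x.1)).
    move=> x; apply: (@continuous_comp _ _ _ (fun x : R * R => (x.2, x.1)) Th).
      by apply: (@continuous_pair (R * R)%type R R snd fst); [exact: cvg_snd|exact: cvg_fst].
    exact: cTh.
  have := angle_on_unique plane_lc_connected (angle_onT cTh aTh)
    (angle_onT cs (f := G) _) (x := (s, t)) (y := (s, s)) I I.
  move=> /(_ _)/= h; suff : Th (s, t) - Th (t, s) = Th (s, s) - Th (s, s) by lra.
  by apply: h => x; rewrite /G addrC; exact: (aTh (x.2, x.1)).
have incr s : Th (1, s) - Th (0, s) = Th (1, 0) - Th (0, 0).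
  have a1 := angle_onT (cl _ _ (cc 1) cid') (f := fun s => G (1, s))
    (fun t => aTh (1, t)).
  have a2 : angle_on [set: R] (fun s => G (1, s)) (fun s => Th (0, s)).
    apply: angle_onT; first exact: cl.
    by move=> t; rewrite /G /= -q01; exact: (aTh (0, t)).
  have := @angle_on_unique _ _ _ _ _ line_lc_connected a1 a2 s 0 I I.
  by lra.
(* By symmetry the diagonal increment is the sum of the horizontal increments at heights 1 and 0,
   which are equal; so it vanishes as soon as one horizontal increment does. *)
suff k0 : exists s, Th (1, s) - Th (0, s) = 0.
  case: k0 => s; rewrite incr => k0; rewrite diag.
  have := incr 1; rewrite (swap 0 1); lra.
pose N t := pdot (q t) (q t).
have cN : continuous N.
  have d1 : continuous (fun t => (q t).1).
    by move=> t; apply: continuous_comp; [exact: cq|exact: cvg_fst].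
  have d2 : continuous (fun t => (q t).2).
    by move=> t; apply: continuous_comp; [exact: cq|exact: cvg_snd].
  by move=> t; apply: cvgD; apply: cvgM; solve [exact: d1|exact: d2].
have [s s01 maxs] := @EVT_max R N 0 1 ler01 (continuous_subspaceT cN).
have {}maxs t : N t <= N s.
  have [t0|t0] := leP t 0; first by rewrite /N q0// -(q0 0)// maxs// in_itv/= lexx ler01.
  have [t1|t1] := leP 1 t; first by rewrite /N q1// -(q1 1)// maxs// in_itv/= lexx ler01.
  by apply: maxs; rewrite in_itv/= !ltW.
exists s.
(* As q(t) is no longer than q(s), the squared norm of q(t) + q(s) is at most twice this product. *)
have half t : 0 < pdot (q s) (G (t, s)).
  have := G0 (t, s); have := maxs t; rewrite /N /G /pdot /=.
  case: (q t) (q s) => [x y] [z w] /= h1 h2.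
  have e1 := sqr_ge0 (x + z); have e2 := sqr_ge0 (y + w).
  have [zs|/eqP zs] := eqVneq (x + z) 0.
    have [ws|/eqP ws] := eqVneq (y + w) 0.
      by exfalso; apply: h2; rewrite -[(_, _) + _]/(x + z, y + w) zs ws.
    have : 0 < (y + w) ^+ 2 by rewrite exprn_even_gt0//=; apply/eqP.
    nra.
  have : 0 < (x + z) ^+ 2 by rewrite exprn_even_gt0//=; apply/eqP.
  nra.
have qs0 : q s <> (0, 0).
  by move=> E; have := half 0; rewrite E /pdot /= !mul0r addr0 ltxx.
have [al as_] := angle_exists qs0.
have cGs : continuous (fun t => G (t, s)).
  move=> t; apply: (@continuous_comp _ _ _ (fun t => (t, s)) G).
    exact: (continuous_pair (cid' t) (cc s t)).
  exact: cG.
have ct : continuous (fun t => al + turn (q s) (G (t, s))).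
  move=> t; apply: (@continuousD R R R (fun=> al)); first exact: cst_continuous.
  exact: (turn_continuous cGs).
rewrite (@line_angle_unique (fun t => G (t, s)) (fun t => Th (t, s)) _ _ ct) //.
- by rewrite /G /= q01 subrr.
- exact: cl.
- by move=> t; apply: angle_turn.
Qed.

(** * Angles and turning along arcs in space *)

Section ArcTurns.
Variables (D : set (space3 R)) (P : space3 R -> R * R).
Hypothesis cP : forall x, D x -> {for x, continuous P}.
Hypothesis P0 : forall x, D x -> P x <> (0, 0).

Definition clamp (t : R) : R := Num.max 0 (Num.min t 1).

Lemma clamp01 t : 0 <= clamp t <= 1.
Proof. by rewrite /clamp le_max lexx ge_max ler01 ge_min lexx orbT. Qed.

Lemma clamp_id t : 0 <= t <= 1 -> clamp t = t.
Proof. by move=> /andP[t0 t1]; rewrite /clamp min_l// max_r. Qed.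

Lemma clamp_le0 t : t <= 0 -> clamp t = 0.
Proof. by move=> t0; rewrite /clamp max_l// ge_min t0. Qed.

Lemma clamp_ge1 t : 1 <= t -> clamp t = 1.
Proof. by move=> t1; rewrite /clamp min_r// max_r. Qed.

Lemma clamp_dist s t : `|clamp s - clamp t| <= `|s - t|.
Proof.
wlog st : s t / s <= t.
  by move=> h; have [/h//|/ltW/h] := leP s t; rewrite distrC (distrC t).
have : clamp s <= clamp t /\ clamp t - clamp s <= t - s.
  have cid u : 0 <= u -> u <= 1 -> clamp u = u.
    by move=> ? ?; apply: clamp_id; apply/andP.
  have [s0|/ltW s0] := leP s 0; have [t0|/ltW t0] := leP t 0;
  have [s1|/ltW s1] := leP 1 s; have [t1|/ltW t1] := leP 1 t;
  rewrite ?(clamp_le0 s0) ?(clamp_le0 t0) ?(clamp_ge1 s1) ?(clamp_ge1 t1)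
    ?(cid s) ?(cid t) //; split; lra.
move=> [h1 h2]; rewrite distrC ger0_norm ?subr_ge0// distrC ger0_norm ?subr_ge0//.
Qed.

Lemma clamp_arc_continuous (g : R -> space3 R) :
  {within `[0, 1], continuous g} -> continuous (g \o clamp).
Proof.
move=> cg t U Ut; have [d d0 dU] := near_arc cg (clamp01 t) Ut.
apply/nbhs_ballP; exists d => // s; rewrite /ball/= => st.
apply: dU; first exact: clamp01.
by apply: le_lt_trans (clamp_dist s t) _; rewrite distrC.
Qed.

Lemma arc_path_continuous (g : R -> space3 R) : {within `[0, 1], continuous g} ->
  (forall t, 0 <= t <= 1 -> D (g t)) -> continuous (fun t => P (g (clamp t))).
Proof.
move=> cg gD t; apply: (@continuous_comp _ _ _ (g \o clamp) P).
  exact: clamp_arc_continuous.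
by apply: cP; apply: gD; exact: clamp01.
Qed.

(** The angle is lifted along a parametrization and carried back by its inverse [k]. *)
Lemma arc_angle x y A : is_arc x y A -> A `<=` D ->
  exists th, angle_on A P th.
Proof.
move=> [g [cg ig g0 g1 AE]] AD; have ginj := arc_inj ig.
have gA t : 0 <= t <= 1 -> A (g t).
  by move=> t01; rewrite AE; exists t; rewrite //= in_itv.
have gD t : 0 <= t <= 1 -> D (g t) by move=> /gA/AD.
have [th [cth ath]] := line_angle_lift (arc_path_continuous cg gD)
  (fun t => P0 (gD _ (clamp01 t))).
have /choice[k kE] : forall x, exists t, A x -> 0 <= t <= 1 /\ g t = x.
  move=> z; have [|nz] := pselect (A z); last by exists 0.
  by rewrite {1}AE => -[t /=]; rewrite in_itv/= => t01 <-; exists t.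
exists (th \o k); split=> z Az.
  have [k01 kz] := kE z Az.
  by have := ath (k z); rewrite clamp_id// kz.
move=> d d0; have [k01 kz] := kE z Az.
(* The parameters with a distant angle form a compact set whose image misses [z], so points of the
   arc close to [z] have parameters outside it. *)
pose B := [set t | 0 <= t <= 1 /\ d <= `|th t - th (k z)|].
have kB : compact B.
  have -> : B = `[0, 1] `&` (fun t => `|th t - th (k z)|) @^-1` [set r | d <= r].
    by apply/seteqP; split => t; rewrite /B/= in_itv.
  apply: compact_closedI; first exact: segment_compact.
  apply: closed_comp; last exact: closed_ge.
  move=> t _; apply: cvg_norm; apply: cvgB; [exact: cth|exact: cvg_cst].
have cgB : closed (g @` B).
  apply: compact_closed; first exact: norm_hausdorff.
  apply: continuous_compact kB; apply: continuous_subspaceW cg => t [t01 _].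
  by rewrite /= in_itv.
have nz : ~ (g @` B) z.
  move=> [t [t01 dt]] gt; have tk : t = k z by apply: ginj; rewrite ?gt.
  by move: dt; rewrite tk subrr normr0 leNgt d0.
apply: filterS (closed_escape cgB nz) => w nw Aw.
have [kw01 kw] := kE w Aw.
rewrite ltNge; apply/negP => dw; apply: nw; exists (k w) => //.
Qed.

Lemma arc_turns x y A th : is_arc x y A -> A `<=` D -> angle_on A P th ->
  turns (P @` A) (P x) (P y) (th y - th x).
Proof.
move=> [g [cg ig g0 g1 AE]] AD [ath cth].
have gA t : 0 <= t <= 1 -> A (g t).
  by move=> t01; rewrite AE; exists t; rewrite //= in_itv.
have gD t : 0 <= t <= 1 -> D (g t) by move=> /gA/AD.
exists (fun t => P (g (clamp t))), (fun t => th (g (clamp t))); split.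
- split; first exact: arc_path_continuous.
  move=> t; apply/cvgrPdist_lt => d d0.
  have h : nbhs (g (clamp t))
      [set w | A w -> `|th w - th (g (clamp t))| < d].
    exact: cth (gA _ (clamp01 t)) d d0.
  have h' : nbhs t ((g \o clamp) @^-1`
      [set w | A w -> `|th w - th (g (clamp t))| < d]).
    exact: clamp_arc_continuous cg _ _ h.
  apply: filterS h' => w /= hw; rewrite distrC; apply: hw.
  exact: gA (clamp01 _).
- by move=> t; exists (g (clamp t)) => //; exact: gA (clamp01 _).
- by move=> t; apply: ath; exact: gA (clamp01 _).
- split=> t ht; rewrite ?(clamp_le0 ht) ?(clamp_ge1 ht) ?g0 ?g1//.
    by rewrite clamp_le0// g0.
  by rewrite clamp_ge1// g1.
- by rewrite clamp_ge1// clamp_le0// g0 g1.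
Qed.

End ArcTurns.
End Angles.

(** * Linear isometries *)

Section LinearIsometries.
Context {R : realType}.
Implicit Types (x y p c : space3 R).

Lemma edist_dot x y : sphere x -> sphere y -> Defs.edist x y ^+ 2 = 2 - 2 * dot x y.
Proof.
move=> /sphereE xx /sphereE yy; rewrite sqr_sqrtr; last first.
  by apply: sumr_ge0 => k _; exact: sqr_ge0.
transitivity (dot (x - y) (x - y)).
  by apply: eq_bigr => k _; rewrite !mxE expr2.
by rewrite !dotE xx yy (dotC y x); ring.
Qed.

Record linear_isometry (L : space3 R -> space3 R) : Prop := {
  isoD : forall x y, L (x + y) = L x + L y;
  isoZ : forall r x, L (r *: x) = r *: L x;
  iso_dot : forall x y, dot (L x) (L y) = dot x y;
  iso_continuous : continuous L
}.

Lemma frame_dot a b u x y : frame a b u ->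
  dot x y = dot x a * dot y a + dot x b * dot y b + dot x u * dot y u.
Proof.
move=> abu; rewrite {1}(frame_expand x abu) !dotE.
by rewrite !(dotC y).
Qed.

Lemma frame_std : frame (vec3 1 0 0 : space3 R) (vec3 0 1 0) (vec3 0 0 1).
Proof. by split; first split; rewrite dot_vec3 !mxE /=; ring. Qed.

(** An isometry of the sphere preserves dot products, so [f x] has in the image of the standard
    frame the coordinates that [x] has in that frame. *)
Lemma isometry_linear f : sphere_isometry f ->
  exists2 L, linear_isometry L & forall x : space3 R, sphere x -> f x = L x.
Proof.
move=> [[fS _ _] fd].
have fS' x : sphere x -> sphere (f x) by move=> /fS.
have fdot x y : sphere x -> sphere y -> dot (f x) (f y) = dot x y.
  move=> Sx Sy; have := edist_dot (fS' _ Sx) (fS' _ Sy).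
  by rewrite fd// edist_dot//; lra.
have std := frame_std.
move: std; set e0 := vec3 1 0 0; set e1 := vec3 0 1 0; set e2 := vec3 0 0 1.
move=> std; case: (std) => -[/sphereE S0 /sphereE S1 /sphereE S2] d01 d02 d12.
have F : frame (f e0) (f e1) (f e2).
  by split; [split; apply/sphereE; exact: fS'|..]; rewrite fdot.
case: (F) => -[F0 F1 F2] F01 F02 F12.
have F10 : dot (f e1) (f e0) = 0 by rewrite dotC.
have F20 : dot (f e2) (f e0) = 0 by rewrite dotC.
have F21 : dot (f e2) (f e1) = 0 by rewrite dotC.
pose L x := dot x e0 *: f e0 + dot x e1 *: f e1 + dot x e2 *: f e2.
exists L; last first.
  by move=> x Sx; rewrite [LHS](frame_expand _ F) !fdot.
split.
- move=> x y; rewrite /L !dotDl !scalerDl.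
  by rewrite [RHS]addrACA; congr (_ + _); rewrite addrACA.
- by move=> r x; rewrite /L !dotZl !scalerDr !scalerA.
- move=> x y; rewrite (frame_dot x y std) /L !dotE.
  by rewrite F0 F1 F2 F01 F02 F12 F10 F20 F21; ring.
- have cZ (v w : space3 R) : continuous (fun x => dot x v *: w).
    move=> x; apply: (@continuousZ R (space3 R) (space3 R) (fun x => dot x v) (fun=> w)).
      exact: dot_continuous.
    exact: cst_continuous.
  move=> x.
  apply: (@continuousD R (space3 R) (space3 R) (fun x => dot x e0 *: f e0 + dot x e1 *: f e1)); last exact: cZ.
  by apply: (@continuousD R (space3 R) (space3 R) (fun x => dot x e0 *: f e0)); exact: cZ.
Qed.

Variable L : space3 R -> space3 R.
Hypothesis isoL : linear_isometry L.

Let LD := isoD isoL.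
Let LZ := isoZ isoL.
Let Ldot := iso_dot isoL.

Lemma isoN x : L (- x) = - L x.
Proof. by rewrite -scaleN1r LZ scaleN1r. Qed.

Lemma sphere_antipodal p q : sphere p -> sphere q -> dot p q ^+ 2 = 1 ->
  q = p \/ q = - p.
Proof.
move=> Sp Sq /eqP; rewrite sqrf_eq1 => /orP[]/eqP pq; [left|right];
  apply: contrapT => h.
  by have := sphere_dot_lt1 Sq Sp h; rewrite dotC pq ltxx.
by have := sphere_dot_lt1 Sq (sphere_opp Sp) h; rewrite dotNr dotC pq opprK ltxx.
Qed.

(* The square of L fixes a frame vector or reverses it; in the latter case L
   maps it into the plane fixed by the square of L, which is absurd. *)
Lemma iso_involutive p q : sphere p -> sphere q -> q <> p -> q <> - p ->
  L (L p) = p -> L (L q) = q -> forall x, L (L x) = x.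
Proof.
move=> Sp Sq qp qNp Lp Lq.
(* Gram-Schmidt, to complete [p] to a frame whose first two vectors are fixed by the square of
   [L]. *)
pose w := q + (- dot p q) *: p.
have /sphereE pp := Sp; have /sphereE qq := Sq.
have w0 : w <> 0.
  move=> w0; have : dot w w = 0 by rewrite w0 -(scale0r p) dotZl mul0r.
  rewrite /w !dotE pp qq (dotC q p) => h.
  have : dot p q ^+ 2 = 1 by rewrite expr2; lra.
  by move=> /(sphere_antipodal Sp Sq)[].
have [r r0 ww] := normalize w0.
have pw : dot p (r *: w) = 0 by rewrite /w !dotE pp; ring.
have [u fr] := frame_cross pp ww pw.
have Lw : L (L (r *: w)) = r *: w by rewrite /w !(LZ, LD) Lp Lq.
move: (r *: w) ww pw Lw fr => e ww pw Lw fr.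
case: (fr) => -[_ _ uu] _ pu eu.
have NuE : L (L u) = dot (L (L u)) u *: u.
  have h1 : dot (L (L u)) p = 0 by rewrite -Lp !Ldot dotC.
  have h2 : dot (L (L u)) e = 0 by rewrite -Lw !Ldot dotC.
  by rewrite {1}(frame_expand (L (L u)) fr) h1 h2 !scale0r !add0r.
have : dot (L (L u)) u ^+ 2 = 1.
  have := Ldot (L u) (L u); rewrite {1 2}NuE Ldot uu !dotE uu => h.
  by rewrite expr2 -h mulr1.
move=> /eqP; rewrite sqrf_eq1 => /orP[]/eqP h; rewrite h in NuE.
  move=> x; rewrite {1}(frame_expand x fr) !(LZ, LD) Lp Lw NuE scale1r.
  by rewrite -frame_expand.
exfalso; rewrite scaleN1r in NuE.
have yu : dot (L u) u = 0.
  by have := Ldot (L u) u; rewrite NuE dotNl (dotC u); lra.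
have yE : L (L (L u)) = L u.
  rewrite {1 2}(frame_expand (L u) fr) yu scale0r addr0 !(LZ, LD).
  by rewrite Lp Lw.
have : dot (L u) (L u) = 0.
  by have := congr1 (dot (L u)) yE; rewrite NuE isoN dotNr; lra.
by rewrite Ldot uu => /eqP; rewrite oner_eq0.
Qed.

Hypothesis LL : forall x, L (L x) = x.

Lemma iso_antisym x : L (x - L x) = - (x - L x).
Proof. by rewrite LD isoN LL opprB addrC. Qed.

(** Any nonzero [x - L x] is reversed by [L]. If such a vector [c] exists, either the plane
    orthogonal to it is fixed pointwise, or it contains a second reversed vector; the third frame
    vector is then fixed or reversed. *)
Lemma iso_classification :
  [\/ forall x, L x = - x, forall x, L x = x,
      exists c, [/\ dot c c = 1, L c = - c &
        forall x, dot x c = 0 -> L x = x] |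
      exists a b n, [/\ frame a b n, L a = - a, L b = - b & L n = n]].
Proof.
have [id|/existsNP[x Lx]] := pselect (forall x, L x = x); first exact: Or42.
have neg z : L z <> z -> exists c, [/\ dot c c = 1, L c = - c &
    exists r, c = r *: (z - L z)].
  move=> Lz; have [|r r0 cc] := @normalize _ (z - L z).
    by move/eqP; rewrite subr_eq0 => /eqP/esym.
  exists (r *: (z - L z)); split=> //; last by exists r.
  by rewrite LZ iso_antisym scalerN.
have [c [cc Lc _]] := neg x Lx.
have orth z : dot z c = 0 -> dot (L z) c = 0.
  by move=> zc; have := Ldot z c; rewrite Lc dotNr zc; lra.
have [fix_|/existsNP[z nz]] := pselect (forall x, dot x c = 0 -> L x = x).
  by apply: Or43; exists c.
have [zc Lz] : dot z c = 0 /\ L z <> z.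
  by split; [apply: contrapT => h|move=> h]; apply: nz.
have [c' [cc' Lc' [r c'E]]] := neg z Lz.
have cc'0 : dot c c' = 0.
  by rewrite dotC c'E !dotE zc orth//; ring.
have [n fr] := frame_cross cc cc' cc'0.
case: (fr) => -[_ _ nn] _ cn c'n.
have nE : L n = dot (L n) n *: n.
  rewrite {1}(frame_expand (L n) fr).
  have -> : dot (L n) c = 0 by apply: orth; rewrite dotC.
  have -> : dot (L n) c' = 0.
    by have := Ldot n c'; rewrite Lc' dotNr (dotC n) c'n; lra.
  by rewrite !scale0r !add0r.
have : dot (L n) n ^+ 2 = 1.
  have := Ldot n n; rewrite {1 2}nE !dotE nn => h.
  by rewrite expr2 -h mulr1.
move=> /eqP; rewrite sqrf_eq1 => /orP[]/eqP h; rewrite h in nE.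
  by apply: Or44; exists c, c', n; rewrite nE scale1r.
apply: Or41 => y; rewrite {1}(frame_expand y fr) !(LD, LZ) Lc Lc' nE.
by rewrite scaleN1r !scalerN -!opprD -frame_expand.
Qed.

End LinearIsometries.

(** * The strong involution *)

Section Involution.
Context {R : realType} {V : finType} {e : rel V} {j : embedding R e}.
Variables (tau : V -> faces j) (i : embedding R (square_adj j)).
Variables (sigma : square_vertex j -> square_vertex j) (L : space3 R -> space3 R).
Hypothesis e_sym : symmetric e.
Hypothesis e_connected : forall u v, connect e u v.
Hypothesis e_nbr : forall v, exists u, e v u.
Hypothesis tau_involution : strong_involution tau.
Hypothesis sigma_aut : graph_automorphism (square_adj j) sigma.
Hypothesis sigma_act : square_action tau sigma.
Hypothesis isoL : linear_isometry L.
Hypothesis L_pt : forall c, L (pt i c) = pt i (sigma c).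
Hypothesis L_arc : forall c c', square_adj j c c' ->
  L @` arc i c c' = arc i (sigma c) (sigma c').

Local Notation adj := (square_adj j).

Implicit Types (a b : edge e) (v : V) (c : square_vertex j) (x : space3 R).

Lemma tau_surj f : exists v, tau v = f.
Proof. by case: tau_involution => -[[g _ gK] _] _ _; exists (g f). Qed.

Lemma sigmaV v : sigma (SqV j v) = SqF (tau v).
Proof. by case: sigma_act. Qed.

Lemma sigmaF v : sigma (SqF (tau v)) = SqV j v.
Proof. by case: sigma_act. Qed.

Lemma sigmaE a v : v \in val a ->
  exists2 q, sigma (SqE j a) = SqE j q & edge_on_face q (tau v).
Proof.
move=> /(edge_other_end e_sym)[u _ av]; case: sigma_act => _ _ /(_ a v u av).
by move=> [q [aq qv _]]; exists q.
Qed.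

Lemma edge_end (a : edge e) : exists v, v \in val a.
Proof. by have [u [v [_ ->]]] := edge_ends a; exists u; rewrite !inE eqxx. Qed.

(** The edge [sigma (SqE j a)] lies on [tau v]; if [v] were one of its ends, [v] would lie on
    [tau v]. *)
Lemma sigmaE_avoid a b v : v \in val a -> v \in val b ->
  sigma (SqE j a) <> SqE j b.
Proof.
move=> va vb; have [q -> qv] := sigmaE va; move=> [qb]; rewrite qb in qv.
by case: tau_involution => _ _ /(_ v); apply; exact: edge_vertex_on_face vb qv.
Qed.

Lemma sigma_free c : sigma c <> c.
Proof.
case: c => [v|f|a]; first by rewrite sigmaV.
- by have [v <-] := tau_surj f; rewrite sigmaF.
- by have [v va] := edge_end a; exact: (sigmaE_avoid va va).
Qed.

Definition is_edge (c : square_vertex j) := if c is SqE _ then true else false.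

Lemma sigma_is_edge c : is_edge (sigma c) = is_edge c.
Proof.
case: c => [v|f|a]; first by rewrite sigmaV.
- by have [v <-] := tau_surj f; rewrite sigmaF.
- by have [v va] := edge_end a; have [q -> _] := sigmaE va.
Qed.

Lemma adj_not_edge c a : adj c (SqE j a) -> is_edge c = false.
Proof. by case: c. Qed.

Lemma adj_sigma c a : adj c (SqE j a) ->
  exists2 q, sigma (SqE j a) = SqE j q & adj (sigma c) (SqE j q).
Proof.
move=> ca; have [v va] := edge_end a; have [q aq _] := sigmaE va.
by exists q => //; rewrite -aq; case: sigma_aut => _ ->.
Qed.

Lemma arc_ends c a : adj c (SqE j a) ->
  arc i c (SqE j a) (pt i c) /\ arc i c (SqE j a) (pt i (SqE j a)).
Proof.
move=> /(arc_is_arc i)[g [_ _ <- <- ->]].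
by split; [exists 0|exists 1] => //=; rewrite in_itv/= lexx ler01.
Qed.

Lemma arc_connected c a : adj c (SqE j a) -> connected (arc i c (SqE j a)).
Proof.
move=> /(arc_is_arc i)[g [cg _ _ _ ->]].
by apply: connected_continuous_connected => //; exact: segment_connected.
Qed.

(** The image under [L] of an arc is an arc of the embedding, and two different arcs meet only in
    common ends. As [sigma] respects edges and non-edges, a common end is one of the two excluded
    coincidences. *)
Lemma L_arc_disjoint c a c' b x : adj c (SqE j a) -> adj c' (SqE j b) ->
  sigma c <> c' -> sigma (SqE j a) <> SqE j b ->
  arc i c (SqE j a) x -> ~ arc i c' (SqE j b) (L x).
Proof.
move=> ca cb cc' ab cax.
have [q aq cq] := adj_sigma ca.
have scE : is_edge (sigma c) = false by rewrite sigma_is_edge (adj_not_edge ca).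
have c'E := adj_not_edge cb.
have Lx : arc i (sigma c) (SqE j q) (L x) by rewrite -aq -L_arc//; exists x.
move=> c'x; have [[/cc' //]|[h _]|[w xw]] := arc_meet cq cb Lx c'x.
  by rewrite h in scE.
rewrite xw in Lx c'x.
have [wE|wE] := arc_pt cq Lx; have [wE'|wE'] := arc_pt cb c'x.
- by apply: cc'; rewrite -wE.
- by rewrite -wE wE' in scE.
- by rewrite -wE' wE in c'E.
- by apply: ab; rewrite aq -wE.
Qed.

Lemma L_arc_free c a x : adj c (SqE j a) -> arc i c (SqE j a) x -> L x <> x.
Proof.
move=> ca cax Lx; apply: (L_arc_disjoint ca ca _ _ cax); rewrite ?Lx //;
  exact: sigma_free.
Qed.

(** Connectedness of the graph of squares as an induction principle. A face is reached through an
    edge on it, which exists because the face has a neighbour in the dual graph. *)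
Lemma square_ind (P : square_vertex j -> Prop) :
  (forall c a, adj c (SqE j a) -> P c <-> P (SqE j a)) ->
  forall c c', P c -> P c'.
Proof.
move=> inv.
have VV u v : P (SqV j u) -> P (SqV j v).
  have /connectP[p + ->] := e_connected u v.
  elim: p u => [//|w p IH] u /= /andP[euw pw] Pu; apply: IH pw _.
  have [a aE] := edge_of euw.
  apply/(inv (SqV j w) a); first by rewrite /= aE !inE eqxx orbT.
  by apply/(inv (SqV j u) a) => //; rewrite /= aE !inE eqxx.
have toV c : exists v, P c <-> P (SqV j v).
  case: c => [v|f|a]; first by exists v.
    have [v fv] := tau_surj f; have [u evu] := e_nbr v.
    case: tau_involution => -[_ tE] _ _.
    move: evu; rewrite tE => /asboolP[_ [a [av _]]].
    have [w wa] := edge_end a; exists w; rewrite -fv.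
    have h1 : adj (SqF (tau v)) (SqE j a) by apply/asboolP.
    by rewrite (inv _ _ h1) (inv (SqV j w) a).
  have [w wa] := edge_end a; exists w.
  by rewrite (inv (SqV j w) a).
move=> c c'; have [v ->] := toV c; have [v' ->] := toV c'; exact: VV.
Qed.

(** The arcs avoid the mirror, so the side of it is constant along each arc and the same at all
    vertices; yet [L] exchanges the sides. *)
Lemma iso_not_reflection (c : space3 R) : dot c c = 1 -> L c = - c ->
  (forall x, dot x c = 0 -> L x = x) -> V -> False.
Proof.
move=> cc Lc fix_ v.
have nz d a x : adj d (SqE j a) -> arc i d (SqE j a) x -> dot x c != 0.
  by move=> da dax; apply/negP => /eqP/fix_; exact: L_arc_free dax.
have Lx x : dot (L x) c = - dot x c.
  by have := iso_dot isoL x c; rewrite Lc dotNr; lra.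
pose P d := (0 < dot (pt i d) c).
have PP := @square_ind (fun d => P d = P (SqV j v)) _.
have {}PP : P (SqF (tau v)) = P (SqV j v).
  apply: (PP _ (SqV j v)) => // d a da; rewrite (_ : P d = P (SqE j a))//.
  have [h1 h2] := arc_ends da.
  apply: (connected_locally_constant (f := fun x => 0 < dot x c) (arc_connected da)) h1 h2.
  move=> x dax; have := nz _ _ _ da dax; rewrite neq_lt => /orP[x0|x0].
    have : \forall w \near x, dot w c < 0 by apply: (cvgr_lt _ (@dot_continuous R c x)).
    apply: filterS => w w0 _; rewrite !ltNge; congr (~~ _).
    by rewrite !ltW.
  have : \forall w \near x, 0 < dot w c by apply: (cvgr_gt _ (@dot_continuous R c x)).
  by apply: filterS => w w0 _; rewrite w0 x0.
move: PP; rewrite /P -sigmaV -L_pt Lx.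
have [u evu] := e_nbr v; have [a aE] := edge_of evu.
have va : adj (SqV j v) (SqE j a) by rewrite /= aE !inE eqxx.
have := nz _ _ _ va (arc_ends va).1.
rewrite neq_lt oppr_gt0 => /orP[h|h]; first by rewrite h ltNge ltW.
by rewrite h ltNge ltW.
Qed.

(** * Exclusion of the half-turn *)

Section Rotation.
Variables (a0 b0 n : space3 R).
Hypothesis fr : frame a0 b0 n.
Hypothesis La : L a0 = - a0.
Hypothesis Lb : L b0 = - b0.
Hypothesis Ln : L n = n.

(** Projection from a pole of the axis turns [L] into the central symmetry of the plane, and the
    angle around the axis into the angle at the origin. *)
Let P := stereo a0 b0 n.
Let D : set (space3 R) := [set x | sphere x /\ L x <> x].

Let Dn x : D x -> [/\ sphere x, x <> n & x <> - n].
Proof.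
move=> [Sx Lx]; split=> // E; apply: Lx; rewrite E ?(isoN isoL) Ln //.
Qed.

Let sphere_n : sphere n.
Proof. by apply/sphereE; case: fr => -[]. Qed.

Let cP x : D x -> {for x, continuous P}.
Proof.
move=> /Dn[Sx xn _]; apply: stereo_continuous.
by have := sphere_dot_lt1 Sx sphere_n xn; rewrite lt_neqAle => /andP[].
Qed.

Let P0 x : D x -> P x <> (0, 0).
Proof. by move=> /Dn[Sx xn xNn] /(stereo_eq0 fr Sx xn). Qed.

Let P_L x : P (L x) = (- (P x).1, - (P x).2).
Proof.
have h p q : L p = - p -> dot (L q) p = - dot q p.
  by move=> Lp; have := iso_dot isoL q p; rewrite Lp dotNr; lra.
have hn : dot (L x) n = dot x n by rewrite -{1}Ln (iso_dot isoL).
by rewrite /P /stereo /= (h _ _ La) (h _ _ Lb) hn !mulNr.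
Qed.

Let sphereL x : sphere x -> sphere (L x).
Proof. by move=> /sphereE xx; apply/sphereE; rewrite (iso_dot isoL). Qed.

Let P_inj x y : D x -> D y -> P x = P y -> x = y.
Proof.
move=> /Dn[Sx xn _] /Dn[Sy yn _] E.
by rewrite -(stereoK fr Sx xn) -(stereoK fr Sy yn) -/P E.
Qed.

Let LD x : D x -> D (L x).
Proof.
move=> [Sx Lx]; split; first exact: sphereL.
move=> LLx; apply: Lx; have := iso_dot isoL (L x - x) (L x - x).
rewrite (isoD isoL) LLx (isoN isoL) subrr -{1}(scale0r x) dotZl mul0r.
by move=> /esym/dot_eq0/eqP; rewrite subr_eq0 => /eqP.
Qed.

Let arcD c a : adj c (SqE j a) -> arc i c (SqE j a) `<=` D.
Proof.
by move=> ca x cax; split; [exact: arc_sphere cax|exact: L_arc_free cax].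
Qed.

Let swing_exists c a : exists r, adj c (SqE j a) ->
  exists2 th, angle_on (arc i c (SqE j a)) P th &
  r = th (pt i (SqE j a)) - th (pt i c).
Proof.
have [ca|nca] := pselect (adj c (SqE j a)); last by exists 0.
have [th ath] := arc_angle cP P0 (arc_is_arc i ca) (arcD ca).
by exists (th (pt i (SqE j a)) - th (pt i c)) => _; exists th.
Qed.

Let swing c a : R := projT1 (cid (swing_exists c a)).

Let swingP c a : adj c (SqE j a) ->
  exists2 th, angle_on (arc i c (SqE j a)) P th &
  swing c a = th (pt i (SqE j a)) - th (pt i c).
Proof. by rewrite /swing; case: cid. Qed.

Let swing_turns c a : adj c (SqE j a) ->
  turns (P @` arc i c (SqE j a)) (P (pt i c)) (P (pt i (SqE j a))) (swing c a).
Proof.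
move=> ca; have [th ath ->] := swingP ca.
by apply: (arc_turns cP) ath; [exact: arc_is_arc|exact: arcD].
Qed.

(** The four arcs around the corner project to a loop. Two of its points with sum zero would come
    from some [x] and [L x], both on these arcs, which [L_arc_disjoint] excludes; so [turns_loop]
    applies. *)
Lemma swing_quad v (f : faces j) (a b : edge e) :
  v \in val a -> v \in val b -> edge_on_face a f -> edge_on_face b f ->
  swing (SqV j v) a - swing (SqF f) a = swing (SqV j v) b - swing (SqF f) b.
Proof.
move=> va vb af bf.
have ava : adj (SqV j v) (SqE j a) by [].
have avb : adj (SqV j v) (SqE j b) by [].
have afa : adj (SqF f) (SqE j a) by apply/asboolP.
have afb : adj (SqF f) (SqE j b) by apply/asboolP.
pose in_quad c d := (c = SqV j v \/ c = SqF f) /\ (d = a \/ d = b).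
pose Q x := exists c d, [/\ in_quad c d, adj c (SqE j d) & arc i c (SqE j d) x].
pose S := P @` Q.
have QD x : Q x -> D x by move=> [c [d [_ cd]]]; exact: arcD.
have T c d : in_quad c d -> adj c (SqE j d) ->
    turns S (P (pt i c)) (P (pt i (SqE j d))) (swing c d).
  move=> cd acd; apply: turns_sub (swing_turns acd).
  by move=> _ [x cdx <-]; exists x => //; exists c, d.
(* No vertex or face of the corner is sent to one of the same corner: [v] lies on [f] but not on
   [tau v]. *)
have ncc c d c' d' : in_quad c d -> in_quad c' d' -> sigma c <> c'.
  have nf : tau v <> f.
    move=> E; case: tau_involution => _ _ /(_ v); apply.
    by rewrite E; exact: edge_vertex_on_face va af.
  have [w fw] := tau_surj f.
  move=> [[->|->] _] [[->|->] _]; rewrite ?sigmaV -?fw ?sigmaF//.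
    by move=> [E]; apply: nf; rewrite E.
  by move=> [E]; apply: nf; rewrite -E.
have nee c d c' d' : in_quad c d -> in_quad c' d' ->
    sigma (SqE j d) <> SqE j d'.
  have vd d0 : d0 = a \/ d0 = b -> v \in val d0 by case=> ->.
  by move=> [_ /vd h] [_ /vd h']; exact: sigmaE_avoid h h'.
have := @turns_loop _ S (P (pt i (SqV j v)))
  (swing (SqV j v) a - swing (SqF f) a + (swing (SqF f) b - swing (SqV j v) b)).
move=> h; suff : swing (SqV j v) a - swing (SqF f) a +
  (swing (SqF f) b - swing (SqV j v) b) = 0 by lra.
apply: h.
  move=> _ _ [x Qx <-] [y Qy <-] E.
  have yE : y = L x.
    apply: P_inj; [exact: QD|exact: LD (QD x Qx)|rewrite P_L].
    move: E; case: (P x) (P y) => [s t] [s' t'] [/= h1 h2].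
    by congr pair; lra.
  case: Qx Qy => c [d [cd acd cdx]] [c' [d' [cd' acd' cdy]]].
  rewrite yE in cdy.
  exact: (L_arc_disjoint acd acd' (ncc _ _ _ _ cd cd') (nee _ _ _ _ cd cd')) cdx cdy.
apply: (@turns_cat _ _ _ (P (pt i (SqF f)))).
  apply: (@turns_cat _ _ _ (P (pt i (SqE j a)))).
    by apply: T => //; split; left.
  by apply: turns_rev; apply: T => //; split; [right|left].
apply: (@turns_cat _ _ _ (P (pt i (SqE j b)))).
  by apply: T => //; split; right.
by apply: turns_rev; apply: T => //; split; [left|right].
Qed.

(** An angle function on the image arc, composed with [L] and shifted by pi, is one on the original
    arc; uniqueness compares the increments. *)
Lemma swing_sigma c a q : adj c (SqE j a) -> sigma (SqE j a) = SqE j q ->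
  swing (sigma c) q = swing c a.
Proof.
move=> ca aq; have [q' aq' cq] := adj_sigma ca.
have qq : q' = q by move: aq'; rewrite aq => -[].
rewrite qq in cq.
have [th ath ->] := swingP ca; have [ph [aph cph] ->] := swingP cq.
have LA x : arc i c (SqE j a) x -> arc i (sigma c) (SqE j q) (L x).
  by move=> cax; rewrite -aq -L_arc//; exists x.
have aph' : angle_on (arc i c (SqE j a)) P (fun x => ph (L x) + pi).
  split=> [x cax|x cax d d0].
    have [r r0] := aph _ (LA x cax); rewrite P_L => -[h1 h2].
    exists r => //; rewrite cosDpi sinDpi.
    by rewrite [LHS]surjective_pairing !mulrN -h1 -h2 !opprK.
  have h : nbhs (L x) [set w | arc i (sigma c) (SqE j q) w -> `|ph w - ph (L x)| < d].
    exact: cph (LA x cax) d d0.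
  have h' : nbhs x (L @^-1` [set w | arc i (sigma c) (SqE j q) w -> `|ph w - ph (L x)| < d]).
    exact: (iso_continuous isoL) _ _ h.
  apply: filterS h' => w /= hw caw.
  have -> : ph (L w) + pi - (ph (L x) + pi) = ph (L w) - ph (L x) by ring.
  exact: hw (LA w caw).
have [e1 e2] := arc_ends ca.
have := angle_on_unique (connected_lc (arc_connected ca)) ath aph' e1 e2.
rewrite !L_pt aq; lra.
Qed.

Lemma iso_not_rotation : V -> False.
Proof.
move=> v.
have [h hP] := square_potential e_sym tau_surj swing_quad.
(* Invariance of the swings makes [k] constant along every arc, hence everywhere. *)
pose k c := h (sigma c) - h c.
have kV c : k c = k (SqV j v).
  apply: (@square_ind (fun c => k c = k (SqV j v)) _ (SqV j v)) => // {}c a ca.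
  suff -> : k c = k (SqE j a) by [].
  have [q aq cq] := adj_sigma ca.
  have := swing_sigma ca aq; rewrite (hP _ _ ca) (hP _ _ cq) /k aq; lra.
(* Since [sigma] exchanges [v] and [tau v], the constant [k] equals its own opposite. *)
have k0 : h (sigma (SqV j v)) = h (SqV j v).
  have := kV (SqF (tau v)); rewrite /k sigmaF sigmaV; lra.
have [u evu] := e_nbr v; have [a aE] := edge_of evu.
have va : adj (SqV j v) (SqE j a) by rewrite /= aE !inE eqxx.
have Dv : D (pt i (SqV j v)) by apply: (arcD va); exact: (arc_ends va).1.
have [al alv] := angle_exists (@P0 _ Dv).
(* The potential, shifted to be an angle at [v], is an angle at every vertex; then opposite points
   of the plane share an angle, which [angle_opp] forbids. *)
pose A c := is_angle (P (pt i c)) (h c + (al - h (SqV j v))).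
have AA c : A c.
  apply: (@square_ind A _ (SqV j v)); last by rewrite /A addrC subrK.
  move=> {}c b cb; have [th [ath _] E] := swingP cb.
  move: E; rewrite (hP _ _ cb) => E.
  have [e1 e2] := arc_ends cb; have t1 := ath _ e1; have t2 := ath _ e2.
  split=> hA.
    by have := angle_shift hA t1 t2; rewrite /A; congr is_angle; lra.
  by have := angle_shift hA t2 t1; rewrite /A; congr is_angle; lra.
have := AA (sigma (SqV j v)); rewrite /A -L_pt k0 P_L => w.
have := angle_opp (AA (SqV j v)) w.
by rewrite subrr cos0 ltr10.
Qed.

End Rotation.

Lemma L_antipodal : (3 < #|V|)%N -> forall x, L x = - x.
Proof.
move=> V4.
have /card_gt2P[v1 [v2 [v3 [_ [v12 v23 v31]]]]] : (2 < #|[set: V]%SET|)%N.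
  by rewrite cardsT; exact: ltn_trans V4.
pose p v := pt i (SqV j v).
have pS v : sphere (p v) by exact: pt_sphere.
have p_inj u v : p u = p v -> u = v by move=> /(@pt_inj _ _ _ i)[].
have LLp v : L (L (p v)) = p v by rewrite /p !L_pt sigmaV sigmaF.
(* At most one vertex is placed opposite [p v1], so one of [v2] and [v3] serves. *)
have [v [v1v v1Nv]] : exists v, p v <> p v1 /\ p v <> - p v1.
  have [h|h] := pselect (p v2 = - p v1).
    exists v3; split; first by move/p_inj => E; move: v31; rewrite E eqxx.
    by rewrite -h => /p_inj E; move: v23; rewrite E eqxx.
  by exists v2; split=> // /p_inj E; move: v12; rewrite E eqxx.
have LL := iso_involutive isoL (pS v1) (pS v) v1v v1Nv (LLp v1) (LLp v).
case: (iso_classification isoL LL) => //.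
- move=> id; have := L_pt (SqV j v1); rewrite id => /(@pt_inj _ _ _ i).
  by rewrite sigmaV.
- by move=> [c [cc Lc fix_]]; case: (iso_not_reflection cc Lc fix_ v1).
- by move=> [a [b [n [fr La Lb Ln]]]]; case: (iso_not_rotation fr La Lb Ln v1).
Qed.

End Involution.

Theorem theorem9 (R : realType) (V : finType) (e : rel V)
    (hP : polyhedron R e)
    (j : embedding R e)
    (tau : V -> faces j)
    (htau : strong_involution tau)
    (i : embedding R (square_adj j))
    (hi : isometric_embedding i)
    (sigma : square_vertex j -> square_vertex j)
    (hsigma : graph_automorphism (square_adj j) sigma)
    (hact : square_action tau sigma)
    (ttau : space3 R -> space3 R)
    (hiso : sphere_isometry ttau)
    (hreal : realizes i sigma ttau) :
  forall x : space3 R, sphere x -> ttau x = antipode x.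
Proof.
case: hP => -[e_sym _] _ [V4 conn].
(* Connectedness is the case of an empty removed set in 3-connectedness. *)
have e_connected u v : connect e u v.
  have := conn finset.set0; rewrite cards0 => /(_ isT u v).
  rewrite !inE => /(_ isT isT); apply: connect_sub => x y /= /andP[exy _].
  exact: connect1.
have e_nbr v : exists u, e v u.
  have [w wv] : exists w, w != v.
    have /card_gt1P[x [y [_ _ xy]]] : (1 < #|[set: V]%SET|)%N.
      by rewrite cardsT; exact: ltn_trans V4.
    have [xv|] := eqVneq x v; last by exists x.
    by exists y; rewrite -xv eq_sym.
  have /connectP[[|u p] /=] := e_connected v w.
    by move=> _ E; rewrite E eqxx in wv.
  by move=> /andP[evu _] _; exists u.
have [L isoL LE] := isometry_linear hiso.
have L_pt c : L (pt i c) = pt i (sigma c).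
  by rewrite -LE; [case: hreal|exact: pt_sphere].
(* Arcs lie on the sphere, where [L] and [ttau] agree. *)
have L_arc c c' : square_adj j c c' ->
    [set L x | x in arc i c c'] = arc i (sigma c) (sigma c').
  move=> cc'; case: hreal => _ /(_ c c' cc') <-.
  by apply: eq_imagel => x /(arc_sphere cc')/LE.
move=> x Sx; rewrite LE// /antipode.
exact: (L_antipodal e_sym e_connected e_nbr htau hsigma hact isoL L_pt L_arc V4).
Qed.
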